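(* Fix $\Delta t>0$, $\nu>0$, $f^{\{k\}}\in V_h$, and let $\mathcal{E}^*:[V_{x,h}]^3\to[V_{x,h}]^3$ be defined by $$(\mathcal{E}^*\bm\eta,\bm q_h)_{\Omega_x}=(1+\Delta t\,\nu)(\bm\eta,\bm q_h)_{\Omega_x}+\Delta t\,\mathcal{E}(\bm\eta,\bm q_h)\qquad\forall\,\bm q_h\in[V_{x,h}]^3 .$$ Assume that $\mathcal{E}^*$ is injective on $[V_{x,h}]^3$ (on its realizable elements, for which $\mathcal{E}$ is defined). Let $\{f^\ell,\bm\rho^\ell\}_\ell$, with $f^\ell\in V_h$ and $\bm\rho^\ell\in[V_{x,h}]^3$, be generated by the HOLO iteration: for every $\ell\ge 0$, $$(f^{\ell+1},z_h)+\Delta t\,\mathcal{L}(f^{\ell+1},z_h)=(f^{\{k\}},z_h)+\Delta t\,\nu\,(M(\bm\rho^{\ell+1}),z_h)-\Delta t\,\mathcal{B}(f_-^\ell,z_h)\qquad\forall z_h\in\widehat V_h,$$ $$(\bm\rho^{\ell+1},\bm q_h)_{\Omega_x}+\Delta t\,\mathcal{E}(\bm\rho^{\ell+1},\bm q_h)=(\bm\rho_{f^{\{k\}}},\bm q_h)_{\Omega_x}-\Delta t\big[\mathcal{A}(f^\ell,\bm e\cdot\bm q_h)-\mathcal{E}(\bm\rho_{f^\ell},\bm q_h)\big]-\Delta t\,\mathcal{B}(f_-^\ell,\bm e\cdot\bm q_h)\qquad\forall \bm q_h\in[V_{x,h}]^3 .$$ Suppose that $f^\ell\to f^*\in V_h$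 and $\bm\rho^\ell\to\bm\rho^*\in[V_{x,h}]^3$ as $\ell\to\infty$. Then $\bm\rho_{f^*}=\bm\rho^*$.
   Context: Moments and Maxwellians. $\Omega_x=(a,b)\subset\mathbb{R}$; $\langle\cdot\rangle_v=\int_{\mathbb{R}}(\cdot)\,dv$; $\bm e=(1,v,\tfrac12v^2)^\top$; for a function $w$, $\bm\rho_w=\langle\bm e w\rangle_v$. A vector $\bm\eta$ written as $\bm\eta=(n,nu,\tfrac12n(u^2+\theta))^\top$ with $n>0$, $u\in\mathbb{R}$, $\theta>0$ is called realizable, and then $M(\bm\eta)(v)=\frac{n}{\sqrt{2\pi\theta}}\exp\left(-\frac{(v-u)^2}{2\theta}\right)$, so $\langle\bm e M(\bm\eta)\rangle_v=\bm\eta$. For moment fields $\bm\eta(x)$, $M(\bm\eta)$ is taken pointwise in $x$; all moment fields at which $M$ is evaluated (including limits such as $\bm\rho^*$ and $\bm\rho_{f^*}$) are assumed realizable at every $x$, including one-sided traces at cell endpoints. Discrete spaces. $\mathcal{T}_{x,h_x}$ is a partition of $\Omega_x$ into finitely many intervals, with set of interior nodes $E^{\mathrm I}_{x,h}$. $V_{x,h}$ is the space of functions on $\Omega_x$ that are polynomials of degree $\le\kappa$ on each cell, with no continuity between cells; $[V_{x,h}]^3$ is its vector-valued version. For $v_{\max}>0$ and $N_v$ a positive even integer, $\Omega_v=[-v_{\max},v_{\max}]$, $v_j=-v_{\max}+2jv_{\max}/N_v$, $I_j=(v_{j-1},v_j)$, $j=1,\dots,N_v$. $V_{v,h}$ is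 the space of functions on $\Omega_v$ that are polynomials of degree $\le2$ on each $I_j$, extended by zero to $\mathbb{R}$. Let $\hat I_1=(-\infty,v_1)$, $\hat I_{N_v}=(v_{N_v-1},\infty)$, $\hat I_j=I_j$ otherwise; $\widehat V_{v,h}$ is the space of functions on $\mathbb{R}$ that are polynomials of degree $\le2$ on each $\hat I_j$ (so $1,v,v^2\in\widehat V_{v,h}$). $V_h=V_{x,h}\otimes V_{v,h}$ (trial), $\widehat V_h=V_{x,h}\otimes\widehat V_{v,h}$ (test). $(\cdot,\cdot)_{\Omega_x}$ is the $L^2(\Omega_x)$ inner product and $(w,z)=\int_{\Omega_x\times\mathbb{R}}wz\,dx\,dv$. Forms. At an interior node, with left/right traces $q^-,q^+$: $\{\!\{q\}\!\}=\tfrac12(q^++q^-)$, $[\![q]\!]=q^--q^+$. Let $\partial\Omega_-=\{(a,v):v>0\}\cup\{(b,v):v<0\}$, $\partial\Omega_+=\{(a,v):v<0\}\cup\{(b,v):v>0\}$, and $\bm n=-1$ at $x=a$, $\bm n=+1$ at $x=b$. With $\widehat{vw}=v\{\!\{w\}\!\}+\tfrac{|v|}{2}[\![w]\!]$ and $\partial_{x,h}$ the cellwise $x$-derivative, $$\mathcal{A}(w,z)=-(vw,\partial_{x,h}z)+\sum_{x_e\in E^{\mathrm I}_{x,h}}\int_{\mathbb{R}}\widehat{vw}\,[\![z]\!]\Big|_{x_e}dv+\int_{\partial\Omega_+}vw\,z\,\bm n\,dv,\qquad \mathcal{B}(f_-,z)=\int_{\partial\Omega_-}vf_-\,z\,\bm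 n\,dv,$$ $\mathcal{L}(w,z)=\mathcal{A}(w,z)+\nu(w,z)$, and $\mathcal{E}(\bm\eta,\bm q_h)=\mathcal{A}(M(\bm\eta),\bm e\cdot\bm q_h)$ for $\bm\eta,\bm q_h\in[V_{x,h}]^3$. Inflow data. $f_-$ is the prescribed inflow data on $\partial\Omega_-$, which may depend on the interior solution $f\in V_h$; this dependence is assumed continuous on $V_h$ (so $f^\ell\to f^*$ implies $f_-^\ell\to f_-^*$ and $\mathcal{B}(f_-^\ell,z_h)\to\mathcal{B}(f_-^*,z_h)$ for each $z_h\in\widehat V_h$). $f_-^\ell$ denotes the inflow data evaluated with $f^\ell$. *)

(* Defs.v *)
From HB Require Import structures.
From mathcomp Require Import all_boot all_order all_algebra.
From mathcomp Require Import all_classical all_reals all_analysis.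

Set Implicit Arguments.
Unset Strict Implicit.
Unset Printing Implicit Defensive.

Import Order.TTheory GRing.Theory Num.Theory.
Import numFieldNormedType.Exports.

Local Open Scope classical_set_scope.
Local Open Scope ring_scope.

(* Kinetic functions of (x, v) have type R * R -> R, scalar fields R -> R, and
   fields of moments R -> 'rV[R]_3.  As in [itv_partition a b s], a partition
   of (a, b) is the increasing sequence s of its nodes without a and with last
   element b. *)

Section Moments.
Context {R : realType}.
Implicit Types (eta : 'rV[R]_3) (w : R * R -> R) (q : R -> 'rV[R]_3).

Local Notation mu := (@lebesgue_measure R).

Definition evec (v : R) : 'rV[R]_3 :=
  \row_k [:: 1; v; v ^+ 2 / 2]`_k.

Definition edot q : R * R -> R :=
  fun p => \sum_(k < 3) evec p.2 0 k * q p.1 0 k.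

Definition moments w : R -> 'rV[R]_3 :=
  fun x => \row_k \int[mu]_(v in [set: R]) (evec v 0 k * w (x, v)).

(* (n, n u, n (u^2 + theta) / 2) *)
Definition moment_vector (n u theta : R) : 'rV[R]_3 :=
  \row_k [:: n; n * u; n * (u ^+ 2 + theta) / 2]`_k.

Definition realizable eta : Prop :=
  exists n u theta, [/\ 0 < n, 0 < theta & eta = moment_vector n u theta].

Definition density eta : R := eta 0 0.
Definition velocity eta : R := eta 0 1 / density eta.
Definition temperature eta : R :=
  2 * eta 0 2%:R / density eta - velocity eta ^+ 2.

Definition maxwellian eta (v : R) : R :=
  density eta / Num.sqrt (2 * pi * temperature eta) *
  expR (- ((v - velocity eta) ^+ 2 / (2 * temperature eta))).

Lemma maxwellian_moment_vector (n u theta v : R) : 0 < n ->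
  maxwellian (moment_vector n u theta) v =
  n / Num.sqrt (2 * pi * theta) * expR (- ((v - u) ^+ 2 / (2 * theta))).
Proof.
move=> n0; have nn0 : n != 0 by rewrite gt_eqF.
have uE : velocity (moment_vector n u theta) = u.
  by rewrite /velocity /density !mxE /= mulrC mulKf.
have tE : temperature (moment_vector n u theta) = theta.
  rewrite /temperature uE /density !mxE /= mulrCA divff ?pnatr_eq0// mulr1.
  by rewrite mulrAC divff// mul1r addrAC subrr add0r.
by rewrite /maxwellian uE tE /density !mxE.
Qed.

Definition Maxw (eta : R -> 'rV[R]_3) : R * R -> R :=
  fun p => maxwellian (eta p.1) p.2.

End Moments.

Section Spaces.
Context {R : realType}.
Implicit Types (cells : seq (interval R)) (d : nat) (g : R -> R).

Definition cellwise_poly cells d : set (R -> R) :=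
  [set g | forall I, I \in cells ->
     exists2 p : {poly R}, (size p <= d.+1)%N & {in I, forall x, g x = p.[x]}].

(* Vanishing outside the open cells selects one representative (off the finite
   set of nodes) of each broken polynomial, so that Leibniz equality of
   representatives is equality in the discrete space. *)
Definition broken_poly cells d : set (R -> R) :=
  [set g | cellwise_poly cells d g /\
     forall x, (forall I, I \in cells -> x \notin I) -> g x = 0].

Definition tensor (U W : set (R -> R)) : set (R * R -> R) :=
  [set w | exists m (phi psi : 'I_m -> R -> R),
     (forall i, U (phi i) /\ W (psi i)) /\
     w = fun p => \sum_(i < m) phi i p.1 * psi i p.2].

Definition xcells (a : R) (s : seq R) : seq (interval R) :=
  pairmap (fun x y => `]x, y[) a s.

Definition vnode (vmax : R) (Nv j : nat) : R :=
  - vmax + 2 * j%:R * vmax / Nv%:R.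

(* Cells are numbered from 0: the j-th one lies between v_j and v_(j+1). *)
Definition vcells (vmax : R) (Nv : nat) : seq (interval R) :=
  mkseq (fun j => `]vnode vmax Nv j, vnode vmax Nv j.+1[) Nv.

Definition hat_vcells (vmax : R) (Nv : nat) : seq (interval R) :=
  mkseq (fun j => Interval
    (if j == 0%N then -oo%O else BRight (vnode vmax Nv j))
    (if j.+1 == Nv then +oo%O else BLeft (vnode vmax Nv j.+1))) Nv.

Definition Vx (a : R) (s : seq R) (kappa : nat) : set (R -> R) :=
  broken_poly (xcells a s) kappa.

Definition Vx3 (a : R) (s : seq R) (kappa : nat) : set (R -> 'rV[R]_3) :=
  [set q | forall k, Vx a s kappa (fun x => q x 0 k)].

Definition Vv (vmax : R) (Nv : nat) : set (R -> R) :=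
  broken_poly (vcells vmax Nv) 2.

(* No normalization at the nodes here: 1, v and v^2 must belong to the space. *)
Definition hatVv (vmax : R) (Nv : nat) : set (R -> R) :=
  cellwise_poly (hat_vcells vmax Nv) 2.

Definition Vh (a : R) (s : seq R) (kappa : nat) (vmax : R) (Nv : nat) :=
  tensor (Vx a s kappa) (Vv vmax Nv).

Definition hatVh (a : R) (s : seq R) (kappa : nat) (vmax : R) (Nv : nat) :=
  tensor (Vx a s kappa) (hatVv vmax Nv).

End Spaces.

Section Forms.
Context {R : realType}.
Implicit Types (a b nu : R) (s : seq R) (w z fm : R * R -> R).
Implicit Types (eta q : R -> 'rV[R]_3).

Local Notation mu := (@lebesgue_measure R).

Definition ipx a b eta q : R :=
  \int[mu]_(x in `]a, b[) (\sum_(k < 3) eta x 0 k * q x 0 k).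

Definition ipxv a b w z : R :=
  \int[(mu \x mu)%E]_(p in `]a, b[ `*` [set: R]) (w p * z p).

Definition traceL w (x v : R) : R := lim (w (y, v) @[y --> x^'-]).
Definition traceR w (x v : R) : R := lim (w (y, v) @[y --> x^'+]).

Definition avg w (x v : R) : R := (traceR w x v + traceL w x v) / 2.
Definition jump w (x v : R) : R := traceL w x v - traceR w x v.

Definition flux w (x v : R) : R := v * avg w x v + `|v| / 2 * jump w x v.

(* At the nodes, a null set, the value is irrelevant. *)
Definition dx z : R * R -> R := fun p => derive1 (fun y => z (y, p.2)) p.1.

(* [behead (belast a s)] lists the interior nodes.  In the boundary terms the
   outward normal is -1 at a and +1 at b. *)
Definition Aform a b s w z : R :=
  - ipxv a b (fun p => p.2 * w p) (dx z)
  + \sum_(xe <- behead (belast a s))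
      \int[mu]_(v in [set: R]) (flux w xe v * jump z xe v)
  + (\int[mu]_(v in `]-oo, 0[) (v * traceR w a v * traceR z a v * -1)
     + \int[mu]_(v in `]0, +oo[) (v * traceL w b v * traceL z b v * 1)).

Definition Bform a b fm z : R :=
  \int[mu]_(v in `]0, +oo[) (v * fm (a, v) * traceR z a v * -1)
  + \int[mu]_(v in `]-oo, 0[) (v * fm (b, v) * traceL z b v * 1).

Definition Lform a b s nu w z : R := Aform a b s w z + nu * ipxv a b w z.

Definition Eform a b s eta q : R := Aform a b s (Maxw eta) (edot q).

(* Realizability inside the cells and of the one-sided traces at both ends of
   every cell: the right ends are s and the left ends are [belast a s]. *)
Definition realizable_field a s eta : Prop :=
  [/\ forall I, I \in xcells a s -> {in I, forall x, realizable (eta x)},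
      {in belast a s, forall x,
         realizable (\row_k lim (eta y 0 k @[y --> x^'+]))} &
      {in s, forall x, realizable (\row_k lim (eta y 0 k @[y --> x^'-]))}].

(* [fm f] is the inflow data determined by f.  Convergence of inflow data is
   convergence of its pairings B(., z) with all test functions z; on the
   finite-dimensional trial space it is uniform convergence (all norms being
   equivalent there). *)
Definition inflow_continuous a b s (kappa : nat) (vmax : R) (Nv : nat)
    (fm : (R * R -> R) -> R * R -> R) : Prop :=
  forall (f : nat -> R * R -> R) (fs : R * R -> R),
    (forall l, Vh a s kappa vmax Nv (f l)) -> Vh a s kappa vmax Nv fs ->
    {uniform, f @ \oo --> fs} ->
    forall z, hatVh a s kappa vmax Nv z ->
      Bform a b (fm (f l)) z @[l --> \oo] --> Bform a b (fm fs) z.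

End Forms.

(* Main.v *)
Require Import Defs.
From HB Require Import structures.
From mathcomp Require Import all_boot all_order all_algebra.
From mathcomp Require Import all_classical all_reals all_analysis.
From mathcomp Require Import measurable_realfun ring lra.
Import Order.TTheory GRing.Theory Num.Theory.
Import numFieldNormedType.Exports.
Local Open Scope classical_set_scope.
Local Open Scope ring_scope.

(** The unknown flux term A(f, e . q) is common to both equations of the
    iteration, and eliminating it leaves an identity about [Estar] alone.

    Fix a moment test function q and put z = e . q, which is an admissible
    kinetic test function because 1, v and v^2 / 2 are polynomials of degree
    at most 2.  Pairing a kinetic function with z only sees its moments
    ([ipxv_edot]), and a Maxwellian has the moments it was built from
    ([moments_Maxw]).  So the kinetic equation at step l reads, with
    m_l = (moments f_l, q), m_k = (moments fk, q), r_l = (rho_l, q) and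
    B_l = B(f_-^l, z),

      (1 + dt nu) m_(l+1) + dt A(f_(l+1), z) = m_k + dt nu r_(l+1) - dt B_l,

    while the moment equation at step l + 1 reads

      r_(l+2) + dt E(rho_(l+2), q)
        = m_k - dt (A(f_(l+1), z) - E(moments f_(l+1), q)) - dt B_(l+1).

    Adding them removes A(f_(l+1), z) and m_k, and B_(l+1) - B_l tends to 0 by
    continuity of the inflow data ([limit_of_consecutive_steps]).  In the limit

      (1 + dt nu) (moments fs, q) + dt E(moments fs, q)
        = (1 + dt nu) (rhos, q) + dt E(rhos, q),

    that is, Estar (moments fs) and Estar rhos have the same pairing with every
    q.  Broken polynomials are separated by these pairings ([Vx3_ipx_inj]), so
    the two are equal, and injectivity of [Estar] concludes.

    The analytic content is the passage to the limit in E ([Eform_cvg]).  It is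
    dominated convergence, in the volume term and in every trace term.  On a
    closed cell the limit field is a polynomial whose end values are its traces,
    so its density and temperature are bounded away from 0 and oo
    ([realizable_field_with]); uniform convergence transfers these bounds to the
    late terms of the sequence ([realizable_with_perturb]), and all their
    Maxwellians lie below one Gaussian ([maxwellian_le_gauss]), which absorbs
    the polynomial weights in v.  Trial functions vanish for large velocities, so
    they too lie below a Gaussian and obey the same lemmas. *)

Set Implicit Arguments.
Unset Strict Implicit.
Unset Printing Implicit Defensive.

(** * Integrals of real-valued functions *)

Section IntegralTools.
Context {d : measure_display} {T : measurableType d} {R : realType}.
Variable mu : {measure set T -> \bar R}.
Import HBNNSimple.

(** The integral is a supremum over the simple functions below the integrand,
    and truncating a simple function on a null set does not change its integral;
    so the identity holds for arbitrary [f] and [g].  It allows the cellwise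
    derivative [dx] to be replaced above the nodes. *)
Lemma integral_eq_off_null (N : set T) (f g : T -> \bar R) :
  measurable N -> mu N = 0%E -> (forall x, ~ N x -> f x = g x) ->
  (\int[mu]_x f x = \int[mu]_x g x)%E.
Proof.
move=> mN N0.
have ge0_le (u v : T -> \bar R) : (forall x, 0 <= u x)%E ->
    (forall x, 0 <= v x)%E -> (forall x, ~ N x -> u x = v x) ->
    (\int[mu]_x u x <= \int[mu]_x v x)%E.
  move=> u0 v0 uv; rewrite !ge0_integralTE//.
  apply: ge_ereal_sup => _ [h hu <-].
  pose h' : {nnsfun T >-> R} := mul_nnsfun h (indic_nnsfun R (measurableC mN)).
  have -> : sintegral mu h = sintegral mu h'.
    rewrite -!integralT_nnsfun; apply: ae_eq_integral => //.
    - by apply/measurable_EFinP.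
    - by apply/measurable_EFinP.
    - exists N; split => // x /= /not_implyP[_ hx]; apply: contrapT => Nx.
      by apply: hx; rewrite /= mindicE mem_set ?mulr1.
  apply: ereal_sup_ubound; exists h' => // x.
  rewrite /h' /= mindicE; have [Nx|Nx] := pselect (N x).
    by rewrite memNset ?mulr0//; exact.
  by rewrite mem_set// mulr1 -uv.
move=> fg; rewrite integralE [in RHS]integralE.
have e (u v : T -> \bar R) : (forall x, 0 <= u x)%E ->
    (forall x, 0 <= v x)%E -> (forall x, ~ N x -> u x = v x) ->
    (\int[mu]_x u x = \int[mu]_x v x)%E.
  move=> u0 v0 uv; apply/eqP; rewrite eq_le !ge0_le// => x Nx.
  by rewrite uv.
congr (_ - _)%E; apply: e => // x Nx.
- by rewrite !funeposE fg.
- by rewrite !funenegE fg.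
Qed.

Lemma Rintegral_eq_off_null (D N : set T) (f g : T -> R) :
  measurable N -> mu N = 0%E -> (forall x, D x -> ~ N x -> f x = g x) ->
  \int[mu]_(x in D) f x = \int[mu]_(x in D) g x.
Proof.
move=> mN N0 fg; rewrite Rintegral_mkcond [RHS]Rintegral_mkcond.
rewrite /Rintegral; congr fine.
apply: (integral_eq_off_null (N := N)) => // x Nx.
congr EFin; rewrite !patchE; case: ifPn => // xD.
by apply: fg => //; exact: set_mem.
Qed.

Lemma Rintegral_dominated_cvg (D : set T) (f_ : nat -> T -> R) (f g : T -> R) :
  measurable D -> (forall n, measurable_fun D (f_ n)) ->
  (forall x, D x -> f_ n x @[n --> \oo] --> f x) ->
  mu.-integrable D (EFin \o g) ->
  (forall n x, D x -> `|f_ n x| <= g x) ->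
  \int[mu]_(x in D) f_ n x @[n --> \oo] --> \int[mu]_(x in D) f x.
Proof.
move=> mD mf_ ff ig fg.
have mf : measurable_fun D f by apply: (measurable_fun_cvg (h := f_)) => //.
have [|||||] := @dominated_convergence _ _ _ mu D mD (fun n => EFin \o f_ n)
  (EFin \o f) (EFin \o g).
- by move=> n; apply/measurable_EFinP.
- exact/measurable_EFinP.
- apply: aeW => x Dx /=; apply: cvg_comp (ff x Dx) _; exact: cvg_refl.
- exact: ig.
- by apply: aeW => x n Dx /=; rewrite lee_fin; exact: fg.
move=> iff _ /=; rewrite /Rintegral => cv; apply: fine_cvg.
rewrite fineK//; exact: integrable_fin_num.
Qed.

Lemma bounded_by_integrable (D : set T) (f g : T -> R) :
  measurable D -> measurable_fun D f -> mu.-integrable D (EFin \o g) ->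
  (forall x, D x -> `|f x| <= g x) -> mu.-integrable D (EFin \o f).
Proof.
move=> mD mf ig fg; apply: le_integrable ig => //; first exact/measurable_EFinP.
move=> x Dx /=; rewrite lee_fin (le_trans (fg x Dx))//; exact: ler_norm.
Qed.

Lemma integrable_scale (D : set T) (K : R) (f : T -> R) : measurable D ->
  mu.-integrable D (EFin \o f) ->
  mu.-integrable D (EFin \o (fun x => K * f x)).
Proof.
by move=> mD fi; apply: eq_integrable (integrableZl mD K fi).
Qed.

Lemma integrable_add (D : set T) (f g : T -> R) : measurable D ->
  mu.-integrable D (EFin \o f) -> mu.-integrable D (EFin \o g) ->
  mu.-integrable D (EFin \o (fun x => f x + g x)).
Proof. by move=> mD fi gi; apply: eq_integrable (integrableD mD fi gi). Qed.

Lemma Rintegral_sum (D : set T) (n : nat) (h : 'I_n -> T -> R) :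
  measurable D -> (forall i, mu.-integrable D (EFin \o h i)) ->
  \int[mu]_(x in D) (\sum_(i < n) h i x)
  = \sum_(i < n) \int[mu]_(x in D) h i x.
Proof.
move=> mD ih; rewrite /Rintegral.
under eq_integral do rewrite -sumEFin.
rewrite integral_sum//= -sum_fine// => i _; exact: integrable_fin_num (ih i).
Qed.

End IntegralTools.

(** * Gaussian weights *)

Section GaussianWeight.
Context {R : realType}.
Local Notation mu := (@lebesgue_measure R).

Definition gauss (delta v : R) : R := expR (- (delta * v ^+ 2)).

Lemma gauss_ge0 (delta v : R) : 0 <= gauss delta v.
Proof. exact: expR_ge0. Qed.

Lemma measurable_invr : measurable_fun [set: R] (fun x : R => x^-1).
Proof.
have -> : [set: R] = [set 0] `|` ~` [set 0].
  by rewrite setUv.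
apply/measurable_funU => //; first exact: measurableC.
split; first exact: measurable_fun_set1.
apply: open_continuous_measurable_fun.
  apply: closed_openC; apply: accessible_closed_set1.
  by apply: hausdorff_accessible; exact: Rhausdorff.
move=> x; rewrite inE /= => /eqP x0; exact: inv_continuous.
Qed.

Lemma measurable_sqrtr : measurable_fun [set: R] (@Num.sqrt R).
Proof. apply: continuous_measurable_fun; exact: sqrt_continuous. Qed.

Lemma measurable_gauss (delta : R) (D : set R) :
  measurable_fun D (gauss delta).
Proof.
apply: measurable_funTS; apply: measurableT_comp => //=.
by apply: measurable_funN; apply: measurable_funM => //; exact: measurable_funX.
Qed.

Lemma integrable_gauss (delta : R) (D : set R) : 0 < delta -> measurable D ->
  mu.-integrable D (EFin \o gauss delta).
Proof.
move=> d0 mD; apply: (integrableS measurableT) => //.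
(* The standard deviation of the centred normal law proportional to
   [gauss delta]. *)
pose sg := Num.sqrt (2 * delta)^-1.
have sg0 : 0 < sg by rewrite sqrtr_gt0 invr_gt0 mulr_gt0.
have sg2 : sg ^+ 2 = (2 * delta)^-1.
  by rewrite sqr_sqrtr// invr_ge0 mulr_ge0// ltW.
apply: (@eq_integrable _ _ _ mu setT measurableT (fun x =>
   ((normal_peak sg)^-1)%:E * (normal_pdf 0 sg x)%:E)%E) => //; last first.
  by apply: integrableZl => //; exact: integrable_normal_pdf.
move=> v _ /=; rewrite normal_pdfE ?gt_eqF// -EFinM mulrA mulVf ?mul1r.
  congr (expR _)%:E; rewrite subr0 sg2; field; exact: lt0r_neq0.
by rewrite gt_eqF// normal_peak_gt0 ?gt_eqF.
Qed.

(** Completing the square.  Polynomial weights in [v] are dominated by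
    expR (m |v|), so they cost only half of the Gaussian rate. *)
Lemma expR_mul_gauss (m delta v : R) : 0 < delta ->
  expR (m * `|v|) * gauss delta v
  <= expR (m ^+ 2 / (2 * delta)) * gauss (delta / 2) v.
Proof.
move=> d0; rewrite /gauss -!expRD ler_expR.
rewrite -[v ^+ 2]real_normK ?num_real//; set t := `|v|.
rewrite -subr_ge0.
have -> : m ^+ 2 / (2 * delta) + - (delta / 2 * t ^+ 2) -
   (m * t + - (delta * t ^+ 2)) = (delta * t - m) ^+ 2 / (2 * delta).
  by field; exact: lt0r_neq0.
by rewrite divr_ge0 ?sqr_ge0// mulr_ge0// ltW.
Qed.

Lemma expR_mul_gauss_le (m delta C K t v w : R) : 0 < delta ->
  `|w| <= K * gauss delta v -> `|t| <= C * expR (m * `|v|) ->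
  `|t * w| <= C * K * expR (m ^+ 2 / (2 * delta)) * gauss (delta / 2) v.
Proof.
move=> d0 wK tm; rewrite normrM.
have K0 : 0 <= K.
  rewrite -(pmulr_lge0 _ (expR_gt0 (- (delta * v ^+ 2)))).
  exact: le_trans (normr_ge0 _) wK.
have C0 : 0 <= C.
  rewrite -(pmulr_lge0 _ (expR_gt0 (m * `|v|))).
  exact: le_trans (normr_ge0 _) tm.
apply: (le_trans (ler_pM _ _ tm wK)) => //.
by rewrite mulrACA -[leRHS]mulrA ler_wpM2l ?mulr_ge0// expR_mul_gauss.
Qed.

Lemma normr_le_expR (v : R) : `|v| <= expR `|v|.
Proof. by rewrite (le_trans _ (expR_ge1Dx _))// lerDr. Qed.

Lemma evec_le_expR (v : R) (k : 'I_3) : `|evec v 0 k| <= expR (2 * `|v|).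
Proof.
have e1 : 1 <= expR `|v| by rewrite -expR0 ler_expR.
have e2 : expR (2 * `|v|) = expR `|v| ^+ 2 by rewrite expRM_natl.
rewrite mxE e2; case: k => -[|[|[|//]]] /= _.
- by rewrite normr1 exprn_ege1.
- by apply: (le_trans (normr_le_expR v)); rewrite expr2 ler_peMl// expR_ge0.
- rewrite normrM normrX [X in _ * X]ger0_norm ?invr_ge0//.
  apply: (@le_trans _ _ (`|v| ^+ 2)).
    by rewrite ler_piMr ?sqr_ge0// invf_le1// ler1n.
  by rewrite ler_pXn2r ?nnegrE ?expR_ge0 ?normr_le_expR.
Qed.

Lemma measurable_evec (k : 'I_3) : measurable_fun setT (fun v : R => evec v 0 k).
Proof.
rewrite (_ : (fun v => _) = (fun v => [:: 1; v; v ^+ 2 / 2]`_k)); last first.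
  by apply/funext => v; rewrite mxE.
case: k => -[|[|[|//]]] /= _; first exact: measurable_cst.
  exact: measurable_id.
by apply: measurable_funM => //; exact: measurable_funX.
Qed.

Lemma gauss_cvg0 (delta : R) (F : R -> R) (K : R) : 0 < delta ->
  (forall v, `|F v| <= K * gauss delta v) ->
  (F n%:R @[n --> \oo] --> 0) /\ (F (- n%:R) @[n --> \oo] --> 0).
Proof.
move=> d0 FK.
have inf : delta^-1 *: (n.+1%:R : R)^-1 @[n --> \oo] --> 0.
  rewrite -[X in _ --> X](scaler0 _ delta^-1); apply: cvgZr => //.
  exact: cvg_harmonic.
have gl n v : `|v| = n.+1%:R :> R ->
    gauss delta v <= delta^-1 * (n.+1%:R)^-1.
  move=> vn; rewrite /gauss expRN -invfM lef_pV2 ?posrE ?expR_gt0 ?mulr_gt0//.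
  apply: le_trans (expR_ge1Dx _).
  rewrite -[v ^+ 2]real_normK ?num_real// vn ler_wpDl//.
  apply: ler_wpM2l; first exact: ltW.
  by rewrite expr2 ler_peMl// ler1n.
have K0 : 0 <= K.
  rewrite -(pmulr_lge0 _ (expR_gt0 (- (delta * 0 ^+ 2)))).
  exact: le_trans (normr_ge0 _) (FK 0).
have lim0 (G : R -> R) : (forall v, `|G v| <= K * gauss delta v) ->
    G n%:R @[n --> \oo] --> 0.
  move=> GK; rewrite -(cvg_shiftS (fun n => G n%:R)).
  apply/cvgr0Pnorm_lt => e e0.
  have /cvgr0Pnorm_lt /(_ (e / (K + 1))) := inf.
  have K1 : 0 < K + 1 by rewrite ltr_wpDl.
  move=> /(_ (divr_gt0 e0 K1)); apply: filterS => n nl.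
  rewrite (le_lt_trans (GK _))//.
  rewrite (@le_lt_trans _ _ ((K + 1) * gauss delta n.+1%:R))//.
    by rewrite ler_wpM2r ?gauss_ge0// lerDl.
  rewrite -ltr_pdivlMl// mulrC (le_lt_trans (gl n _ _)) ?ger0_norm//.
  exact: le_lt_trans (ler_norm _) nl.
split; first exact: lim0.
apply: (lim0 (fun v => F (- v))) => v.
by rewrite (le_trans (FK _))// /gauss sqrrN.
Qed.

(** By the fundamental theorem the integral from - n to n is F n - F (- n), and
    Gaussian decay of [F] sends it to 0. *)
Lemma Rintegral_derive_eq0 (F f : R -> R) (delta K K' : R) : 0 < delta ->
  (forall v : R, is_derive v 1 F (f v)) -> continuous f ->
  (forall v, `|f v| <= K * gauss delta v) ->
  (forall v, `|F v| <= K' * gauss delta v) ->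
  \int[mu]_v f v = 0.
Proof.
move=> d0 dF cf fK FK.
have [F1 F2] := gauss_cvg0 d0 FK.
have mf : measurable_fun setT f by exact: continuous_measurable_fun.
pose I n := [set` `[- n%:R : R, n%:R]].
have cF : continuous F.
  by move=> x; apply: differentiable_continuous; apply/derivable1_diffP; case: (dF x).
have E n : \int[mu]_v ((f \_ (I n.+1)) v) = F n.+1%:R - F (- n.+1%:R).
  rewrite -Rintegral_mkcond /Rintegral (@continuous_FTC2 _ f F)//.
  - by rewrite gtrN.
  - exact: continuous_subspaceT.
  - split.
    + by move=> x _; case: (dF x).
    + apply: cvg_at_right_filter; exact: cF.
    + apply: cvg_at_left_filter; exact: cF.
  - by move=> x _; rewrite derive1E; exact: derive_val.
have cv1 : \int[mu]_v ((f \_ (I n.+1)) v) @[n --> \oo] --> \int[mu]_v f v.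
  apply: (Rintegral_dominated_cvg (mu := mu) (g := fun v => K * gauss delta v)) => //.
  - move=> n; apply/(measurable_restrictT _ _).1; first exact: measurable_itv.
    exact: measurable_funTS.
  - move=> v _; apply: cvg_near_cst; near=> n.
    have In : I n.+1 v.
      rewrite /I /= in_itv /= -ler_norml (@le_trans _ _ (n%:R))// ?ler_nat//.
      near: n; exact: nbhs_infty_ger.
    by rewrite patchE mem_set.
  - by apply: integrable_scale => //; exact: integrable_gauss.
  - move=> n v _; rewrite patchE; case: ifPn => _; first exact: fK.
    by rewrite normr0 (le_trans (normr_ge0 _) (fK v)).
have cv2 : F n.+1%:R - F (- n.+1%:R) @[n --> \oo] --> 0.
  rewrite -[X in _ --> X]subr0; apply: cvgB.
    by rewrite (cvg_shiftS (fun n => F n%:R)).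
  by rewrite (cvg_shiftS (fun n => F (- n%:R))).
rewrite (funext E) in cv1.
exact: (cvg_unique _ cv1 cv2).
Unshelve. all: by end_near. Qed.

End GaussianWeight.

(** * Maxwellians and realizable moments *)

Section MaxwellianTheory.
Context {R : realType}.
Local Notation mu := (@lebesgue_measure R).
Implicit Types (eta : 'rV[R]_3) (c : R).

Lemma ord3_case (P : 'I_3 -> Prop) : P 0 -> P 1 -> P 2%:R -> forall k, P k.
Proof.
move=> P0 P1 P2 [[|[|[|//]]] k3].
- by rewrite (_ : Ordinal k3 = 0)//; exact/val_inj.
- by rewrite (_ : Ordinal k3 = 1)//; exact/val_inj.
- by rewrite (_ : Ordinal k3 = 2%:R)//; exact/val_inj.
Qed.

(** For the moments of (n, u, theta) this is n^2 theta, so that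
    realizability becomes positivity of two polynomials in the moments. *)
Definition discriminant eta : R :=
  2 * eta 0 0 * eta 0 2%:R - eta 0 1 ^+ 2.

Lemma realizableP eta : realizable eta <-> 0 < eta 0 0 /\ 0 < discriminant eta.
Proof.
split=> [[n [u [th [n0 th0 ->]]]]|[n0 d0]].
  rewrite /discriminant !mxE /=; split => //.
  have -> : 2 * n * (n * (u ^+ 2 + th) / 2) - (n * u) ^+ 2 = n ^+ 2 * th.
    by field.
  by rewrite mulr_gt0// exprn_gt0.
have nn0 : eta 0 0 != 0 by rewrite gt_eqF.
exists (eta 0 0), (eta 0 1 / eta 0 0), (discriminant eta / eta 0 0 ^+ 2).
split => //; first by rewrite divr_gt0// exprn_gt0.
by apply/rowP; apply: ord3_case; rewrite !mxE /= /discriminant; field.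
Qed.

Lemma temperatureE eta : eta 0 0 != 0 ->
  temperature eta = discriminant eta / eta 0 0 ^+ 2.
Proof. by move=> n0; rewrite /temperature /velocity /density /discriminant; field. Qed.

Lemma temperature_gt0 eta : realizable eta -> 0 < temperature eta.
Proof.
move=> /realizableP[n0 d0].
by rewrite temperatureE ?gt_eqF// divr_gt0// exprn_gt0.
Qed.

(** A Maxwellian field thus vanishes off the open cells, where broken
    polynomials do. *)
Lemma maxwellian0 v : maxwellian (0 : 'rV[R]_3) v = 0.
Proof. by rewrite /maxwellian /density mxE !mul0r. Qed.

Lemma maxwellian_cvg {T : Type} {F : set_system T} {FF : Filter F}
    (e : T -> 'rV[R]_3) eta v : realizable eta ->
  (forall k, e t 0 k @[t --> F] --> eta 0 k) ->
  maxwellian (e t) v @[t --> F] --> maxwellian eta v.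
Proof.
move=> eR ek; have th0 := temperature_gt0 eR.
have /realizableP[n0 _] := eR.
have nn0 : eta 0 0 != 0 by rewrite gt_eqF.
have cn : (density (e t))^-1 @[t --> F] --> (density eta)^-1.
  exact: (cvgV nn0 (ek 0)).
have cu : velocity (e t) @[t --> F] --> velocity eta.
  exact: (cvgM (ek 1) cn).
have cth : temperature (e t) @[t --> F] --> temperature eta.
  apply: cvgB; last exact: (cvgM cu cu).
  apply: (cvgM _ cn); apply: (cvgM _ (ek 2%:R)); exact: cvg_cst.
have cth2 (m : R) : m * temperature (e t) @[t --> F] --> m * temperature eta.
  apply: (cvgM _ cth); exact: cvg_cst.
apply: cvgM; last first.
  apply: (@cvg_comp _ _ _ _ expR); last exact: continuous_expR.
  apply: cvgN; apply: cvgM; last first.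
    by apply: cvgV; rewrite ?gt_eqF ?mulr_gt0.
  by apply: cvgM; apply: (cvgB _ cu); exact: cvg_cst.
apply: cvgM; first exact: (ek 0).
apply: cvgV.
  by rewrite gt_eqF// sqrtr_gt0 !mulr_gt0// pi_gt0.
have := @cvg_comp _ _ _ _ (@Num.sqrt R) F _ _ (cth2 (2 * pi))
  (@sqrt_continuous _ _).
exact.
Qed.

(** One constant keeps density and temperature away from 0 and all the
    moments bounded: the realizable vectors are exhausted by these closed
    bounded sets as [c] tends to 0. *)
Definition realizable_with c eta : Prop :=
  [/\ c <= eta 0 0, c <= discriminant eta & forall k, `|eta 0 k| <= c^-1].

Lemma realizable_withW c eta : 0 < c -> realizable_with c eta -> realizable eta.
Proof.
by move=> c0 [cn cd _]; apply/realizableP; split; exact: lt_le_trans c0 _.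
Qed.

Lemma realizable_with_le c c' eta : 0 < c' -> c' <= c ->
  realizable_with c eta -> realizable_with c' eta.
Proof.
move=> c'0 c'c [cn cd ck]; have c0 := lt_le_trans c'0 c'c.
split; [exact: le_trans cn|exact: le_trans cd|move=> k].
by rewrite (le_trans (ck k))// lef_pV2.
Qed.

(** The radius depends on [c] alone, which is what makes the bounds pass to
    a uniformly convergent sequence of fields. *)
Lemma realizable_with_perturb c : 0 < c ->
  exists2 eps : R, 0 < eps & forall eta eta', realizable_with c eta ->
    (forall k, `|eta' 0 k - eta 0 k| <= eps) -> realizable_with (c / 2) eta'.
Proof.
move=> c0; have ci0 : 0 < c^-1 by rewrite invr_gt0.
have b0 : 0 < 6 * c^-1 + 3 by rewrite addr_gt0// mulr_gt0.
(* The last entry bounds the variation of the discriminant, at most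
   6 eps / c + 3 eps^2, by c / 2. *)
pose eps := Num.min 1 (Num.min (c / 2) (Num.min c^-1 ((c / 2) / (6 * c^-1 + 3)))).
have c20 : 0 < c / 2 by rewrite divr_gt0.
have e0 : 0 < eps by rewrite !lt_min ltr01 c20 ci0 divr_gt0.
have e1 : eps <= 1 by rewrite ge_min lexx.
have e2 : eps <= c / 2 by rewrite !ge_min lexx orbT.
have e3 : eps <= c^-1 by rewrite !ge_min lexx !orbT.
have e4 : eps * (6 * c^-1 + 3) <= c / 2.
  by rewrite -ler_pdivlMr// !ge_min lexx !orbT.
exists eps => // eta eta' [cn cd ck] eta'k.
have H k : exists d, [/\ eta' 0 k = eta 0 k + d, - eps <= d, d <= eps,
    - c^-1 <= eta 0 k & eta 0 k <= c^-1].
  exists (eta' 0 k - eta 0 k); move: (eta'k k) (ck k).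
  by rewrite !ler_norml => /andP[? ?] /andP[? ?]; split => //; ring.
have [d0 [E0 d0a d0b n0a n0b]] := H 0.
have [d1 [E1 d1a d1b n1a n1b]] := H 1.
have [d2 [E2 d2a d2b n2a n2b]] := H 2%:R.
split.
- by rewrite E0; lra.
- move: cd; rewrite /discriminant E0 E1 E2.
  move: e4 e1 e0 e3 ci0; set C := c^-1 => e4 e1 e0 e3 ci0 cd.
  have m1 : - (eps * C) <= eta 0 0 * d2.
    by rewrite -lerNl (le_trans (ler_norm _))// normrN normrM mulrC ler_pM// ler_norml ?d2a
      ?d2b ?n0a ?n0b.
  have m2 : - (eps * C) <= eta 0 2%:R * d0.
    by rewrite -lerNl (le_trans (ler_norm _))// normrN normrM mulrC ler_pM// ler_norml ?d0a
      ?d0b ?n2a ?n2b.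
  have m3 : eta 0 1 * d1 <= eps * C.
    by rewrite (le_trans (ler_norm _))// normrM mulrC ler_pM// ler_norml ?d1a ?d1b ?n1a ?n1b.
  have m4 : - (eps * eps) <= d0 * d2.
    by rewrite -lerNl (le_trans (ler_norm _))// normrN normrM ler_pM// ler_norml ?d2a ?d2b
      ?d0a ?d0b.
  have m5 : d1 ^+ 2 <= eps * eps.
    by rewrite expr2 (le_trans (ler_norm _))// normrM ler_pM// ler_norml ?d1a ?d1b.
  have m6 : eps * eps <= eps by rewrite ler_piMr// ltW.
  have -> : 2 * (eta 0 0 + d0) * (eta 0 2%:R + d2) - (eta 0 1 + d1) ^+ 2 =
    (2 * eta 0 0 * eta 0 2%:R - eta 0 1 ^+ 2) + 2 * (eta 0 0 * d2) +
    2 * (eta 0 2%:R * d0) + 2 * (d0 * d2) - 2 * (eta 0 1 * d1) - d1 ^+ 2 by ring.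
  lra.
- move=> k; have [d [-> da db na nb]] := H k.
  rewrite invf_div ler_norml; apply/andP; split; lra.
Qed.

(** The density is at most c^-1, the velocity at most c^-2 in absolute
    value, and the temperature lies between c^3 and 2 c^-2, whence a common bound for the
    height, the centre and the width of the bell curves. *)
Lemma maxwellian_le_gauss c : 0 < c -> exists K delta : R, 0 < delta /\
  forall eta v, realizable_with c eta -> `|maxwellian eta v| <= K * gauss delta v.
Proof.
move=> c0; pose C := c^-1; have C0 : 0 < C by rewrite invr_gt0.
pose th1 := 2 * C ^+ 2; pose U := C ^+ 2.
have th10 : 0 < th1 by rewrite mulr_gt0// exprn_gt0.
have U0 : 0 < U by rewrite exprn_gt0.
exists (C / Num.sqrt (2 * pi * (c / C ^+ 2)) * expR (U ^+ 2 / (2 * th1))).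
exists (4 * th1)^-1; split; first by rewrite invr_gt0 mulr_gt0.
move=> eta v eR; have [cn cd ck] := eR.
have rR := realizable_withW c0 eR.
have th0 := temperature_gt0 rR.
have n0 : 0 < eta 0 0 := lt_le_trans c0 cn.
have nC : eta 0 0 <= C := le_trans (ler_norm _) (ck 0).
have nV : (eta 0 0)^-1 <= C by rewrite lef_pV2.
have thl : c / C ^+ 2 <= temperature eta.
  rewrite temperatureE ?gt_eqF//.
  apply: ler_pM => //; [exact: ltW|by rewrite invr_ge0 sqr_ge0|].
  by rewrite lef_pV2 ?posrE ?exprn_gt0// ler_pXn2r// nnegrE; exact: ltW.
have thu : temperature eta <= th1.
  rewrite /temperature /density; apply: (@le_trans _ _ (2 * eta 0 2%:R / eta 0 0)).
    by rewrite gerBl sqr_ge0.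
  rewrite /th1 -mulrA ler_wpM2l// expr2.
  apply: (le_trans (ler_norm _)); rewrite normrM ler_pM//.
  by rewrite normfV gtr0_norm.
have uU : `|velocity eta| <= U.
  rewrite /velocity /density normrM /U expr2 ler_pM//.
  by rewrite normfV gtr0_norm.
rewrite /maxwellian normrM [X in _ * X]ger0_norm ?expR_ge0//.
rewrite -[leRHS]mulrA ler_pM ?expR_ge0//.
  rewrite normrM [`|density _|]gtr0_norm//.
  rewrite ger0_norm ?invr_ge0 ?sqrtr_ge0//.
  apply: ler_pM => //; first exact: ltW.
  have p0 : 0 < 2 * pi * (c / C ^+ 2) :> R.
    by rewrite !mulr_gt0// ?pi_gt0// invr_gt0 exprn_gt0.
  have p1 : 0 < 2 * pi * temperature eta by rewrite !mulr_gt0// pi_gt0.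
  rewrite lef_pV2 ?posrE ?sqrtr_gt0//.
  by rewrite ler_wsqrtr// ler_wpM2l// mulr_ge0// pi_ge0.
rewrite /gauss -expRD ler_expR.
set u := velocity eta; set th := temperature eta.
apply: (@le_trans _ _ (- ((v - u) ^+ 2 / (2 * th1)))).
  rewrite lerN2 ler_wpM2l ?sqr_ge0// lef_pV2 ?posrE ?mulr_gt0//.
  by rewrite ler_wpM2l.
(* This is (v - u)^2 >= v^2 / 2 - u^2, with the remainder made explicit. *)
have -> : U ^+ 2 / (2 * th1) - (4 * th1)^-1 * v ^+ 2 =
   - ((v - u) ^+ 2 / (2 * th1)) +
   ((v - 2 * u) ^+ 2 / 2 + (U ^+ 2 - u ^+ 2)) / (2 * th1).
  by field; exact: lt0r_neq0.
rewrite lerDl; apply: divr_ge0; last by rewrite mulr_ge0// ltW.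
apply: addr_ge0; first by rewrite divr_ge0 ?sqr_ge0.
rewrite subr_ge0 -[u ^+ 2]real_normK ?num_real//.
by rewrite ler_pXn2r// nnegrE ltW.
Qed.

Lemma measurable_maxwellian d (T : measurableType d) (D : set T)
    (e : T -> 'rV[R]_3) (w : T -> R) :
  (forall k, measurable_fun D (fun t => e t 0 k)) -> measurable_fun D w ->
  measurable_fun D (fun t => maxwellian (e t) (w t)).
Proof.
move=> me mw.
have mV (g : T -> R) : measurable_fun D g -> measurable_fun D (fun t => (g t)^-1).
  by move=> mg; apply: (measurableT_comp measurable_invr).
have mu_ : measurable_fun D (fun t => velocity (e t)).
  by apply: measurable_funM => //; apply: mV; exact: me.
have mth : measurable_fun D (fun t => temperature (e t)).
  apply: measurable_funB; last exact: measurable_funX.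
  by apply: measurable_funM; [apply: measurable_funM|apply: mV; exact: me].
apply: measurable_funM.
  apply: measurable_funM; first exact: me.
  apply: mV; apply: (measurableT_comp measurable_sqrtr).
  exact: measurable_funM.
apply: measurableT_comp => //=.
apply: measurable_funN; apply: measurable_funM.
  by apply: measurable_funX; exact: measurable_funB.
by apply: mV; exact: measurable_funM.
Qed.

Lemma gauss_bounded_integrable (K delta : R) (w : R -> R) (D : set R) :
  0 < delta -> measurable D -> measurable_fun D w ->
  (forall v, D v -> `|w v| <= K * gauss delta v) ->
  mu.-integrable D (EFin \o w).
Proof.
move=> d0 mD mw wK.
apply: (@bounded_by_integrable _ _ _ mu D w (fun v => K * gauss delta v)) => //.
by apply: integrable_scale => //; exact: integrable_gauss.
Qed.

Lemma expR_gauss_bounded_integrable (C K delta m : R) (t w : R -> R)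
    (D : set R) :
  0 < delta -> measurable D -> measurable_fun D t -> measurable_fun D w ->
  (forall v, D v -> `|t v| <= C * expR (m * `|v|)) ->
  (forall v, D v -> `|w v| <= K * gauss delta v) ->
  mu.-integrable D (EFin \o (fun v => t v * w v)).
Proof.
move=> d0 mD mt mw tm wK.
apply: (gauss_bounded_integrable (delta := delta / 2)
  (K := C * K * expR (m ^+ 2 / (2 * delta)))) => //.
- by rewrite divr_gt0.
- exact: measurable_funM.
- by move=> v Dv; exact: expR_mul_gauss_le (wK v Dv) (tm v Dv).
Qed.

Lemma realizable_with_exists eta : realizable eta ->
  exists2 c, 0 < c & realizable_with c eta.
Proof.
move=> /realizableP[n0 d0].
pose m := `|eta 0 0| + (`|eta 0 1| + `|eta 0 2%:R|).
have m0 : 0 < m by rewrite ltr_pwDl ?addr_ge0// normr_gt0 gt_eqF.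
pose c := Num.min (eta 0 0) (Num.min (discriminant eta) m^-1).
have c0 : 0 < c by rewrite !lt_min n0 d0 invr_gt0.
have cm : m <= c^-1.
  by rewrite -[m]invrK lef_pV2 ?posrE ?invr_gt0// !ge_min lexx !orbT.
exists c => //; split; [by rewrite ge_min lexx|by rewrite !ge_min lexx orbT|].
apply: ord3_case; apply: le_trans cm; rewrite /m.
- by rewrite lerDl addr_ge0.
- by rewrite addrCA lerDl addr_ge0.
- by rewrite addrA lerDr addr_ge0.
Qed.

(** With M the Maxwellian of (n, u, theta), (v - u) M is the derivative of
    - theta M and ((v - u)^2 - theta) M that of - theta (v - u) M.  Their
    integrals vanish, and the three moments are combinations of these two
    integrals and of the total mass n. *)
Lemma maxwellian_moments eta : realizable eta ->
  forall k, \int[mu]_v (evec v 0 k * maxwellian eta v) = eta 0 k.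
Proof.
move=> etaR; have [c c0 etac] := realizable_with_exists etaR.
have [K [delta [d0 MK]]] := maxwellian_le_gauss c0.
have {MK} := fun v => MK _ v etac.
case: etaR => [n [u [th [n0 th0 ->]]]].
set M := maxwellian (moment_vector n u th) => MK.
pose A := n / Num.sqrt (2 * pi * th).
have MEx : M = (fun v => A * expR (- ((v - u) ^+ 2 / (2 * th)))).
  by apply/funext => v; rewrite /M maxwellian_moment_vector.
pose sg := Num.sqrt th.
have sg0 : 0 < sg by rewrite sqrtr_gt0.
have sg2 : sg ^+ 2 = th by rewrite sqr_sqrtr// ltW.
have thn0 : th != 0 by rewrite gt_eqF.
have ME v : M v = n * normal_pdf u sg v.
  rewrite MEx normal_pdfE ?gt_eqF//.
  rewrite /normal_peak /normal_fun sg2 mulrA; congr (_ / Num.sqrt _ * expR _).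
    by rewrite -mulr_natl; ring.
  by rewrite mulNr -[th *+ 2]mulr_natl.
have iM0 : \int[mu]_v M v = n.
  rewrite /Rintegral (_ : (fun v => (M v)%:E) = (fun v => n%:E * (normal_pdf u sg v)%:E)%E).
    rewrite integralZl//; last exact: integrable_normal_pdf.
    by rewrite integral_normal_pdf mule1.
  by apply/funext => v; rewrite ME EFinM.
have dM (v : R) : is_derive v 1 M (- ((v - u) / th) * M v).
  rewrite MEx.
  by apply: is_derive_eq; rewrite /GRing.scale /=; field.
have cM : continuous M.
  move=> v; apply: differentiable_continuous; apply/derivable1_diffP.
  by case: (dM v).
have mM : measurable_fun setT M by exact: continuous_measurable_fun.
(* One constant for the weights - th, v - u and (v - u)^2 - th at once. *)
pose B := (1 + `|u|) ^+ 2 + th.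
have vu (v : R) : `|v - u| <= (1 + `|u|) * expR `|v|.
  rewrite (le_trans (ler_normB _ _))// mulrDl mul1r lerD ?normr_le_expR//.
  by rewrite ler_peMr// -expR0 ler_expR.
have e2 (v : R) : expR (2 * `|v|) = expR `|v| ^+ 2 by rewrite expRM_natl.
have e1 (v : R) : 1 <= expR `|v| by rewrite -expR0 ler_expR.
have u1 : 1 <= 1 + `|u| by rewrite lerDl.
have uB : 1 + `|u| <= B.
  by rewrite /B expr2 ler_wpDr ?(ltW th0)// ler_peMl// (le_trans ler01).
have B0 : 0 <= B by rewrite (le_trans _ uB)// (le_trans ler01).
have vu1 (v : R) : `|v - u| <= B * expR (2 * `|v|).
  rewrite (le_trans (vu v))// e2 ler_pM ?expR_ge0 ?(le_trans ler01)//.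
  by rewrite expr2 ler_peMl ?expR_ge0.
have vu2 (v : R) : `|(v - u) ^+ 2 - th| <= B * expR (2 * `|v|).
  rewrite (le_trans (ler_normB _ _))// mulrDl lerD//.
    by rewrite normrX e2 -exprMn ler_pXn2r ?nnegrE ?mulr_ge0 ?expR_ge0 ?addr_ge0.
  by rewrite gtr0_norm// ler_peMr ?(ltW th0)// e2 exprn_ege1.
have vu0 (v : R) : `|- th| <= B * expR (2 * `|v|).
  rewrite normrN gtr0_norm// -[leLHS]mulr1 ler_pM ?(ltW th0)//.
    by rewrite lerDr sqr_ge0.
  by rewrite e2 exprn_ege1.
pose K' := B * K * expR (2 ^+ 2 / (2 * delta)).
have d20 : 0 < delta / 2 by rewrite divr_gt0.
have bnd (t : R -> R) (v : R) : `|t v| <= B * expR (2 * `|v|) ->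
    `|t v * M v| <= K' * gauss (delta / 2) v.
  by move=> tB; exact: expR_mul_gauss_le (MK v) tB.
pose f1 v := (v - u) * M v.
pose f2 v := ((v - u) ^+ 2 - th) * M v.
have cvu (v : R) : (t - u @[t --> v] --> v - u).
  by apply: cvgB; [exact: cvg_id|exact: cvg_cst].
have f10 : \int[mu]_v f1 v = 0.
  apply: (Rintegral_derive_eq0 (F := fun v => - th * M v) (f := f1)
    (delta := delta / 2) (K := K') (K' := K')) => //.
  - by move=> v; apply: is_derive_eq; rewrite /GRing.scale /= /f1; field.
  - by move=> v; apply: cvgM; [exact: cvu|exact: cM].
  - by move=> v; exact: (bnd (fun v => v - u)).
  - by move=> v; exact: (bnd (fun=> - th)).
have f20 : \int[mu]_v f2 v = 0.
  apply: (Rintegral_derive_eq0 (F := fun v => - th * f1 v) (f := f2)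
    (delta := delta / 2) (K := K') (K' := th * K')) => //.
  - move=> v; rewrite /f1; apply: is_derive_eq; rewrite /GRing.scale /= /f2.
    by field.
  - move=> v; apply: cvgM; last exact: cM.
    by apply: cvgB; [apply: cvgM; exact: cvu|exact: cvg_cst].
  - by move=> v; exact: (bnd (fun v => (v - u) ^+ 2 - th)).
  - move=> v; rewrite normrM normrN (gtr0_norm th0) -(mulrA th).
    apply: ler_wpM2l; first exact: ltW.
    exact: (bnd (fun v => v - u)).
have im (t : R -> R) : measurable_fun setT t ->
    (forall v, `|t v| <= B * expR (2 * `|v|)) ->
    mu.-integrable setT (EFin \o (fun v => t v * M v)).
  by move=> mt tB; exact: (expR_gauss_bounded_integrable (C := B) (K := K) (delta := delta)
    (m := 2)).
have mvu : measurable_fun setT (fun v : R => v - u) by exact: measurable_funB.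
have if1 : mu.-integrable setT (EFin \o f1) by exact: (im (fun v => v - u)).
have if2 : mu.-integrable setT (EFin \o f2).
  apply: (im (fun v => (v - u) ^+ 2 - th)) => //; apply: measurable_funB => //; exact:
    measurable_funX.
have iM : mu.-integrable setT (EFin \o M).
  exact: (gauss_bounded_integrable (K := K) (delta := delta)).
(* Only the coefficient of M contributes. *)
have lin (x1 x2 x3 : R) :
    \int[mu]_v (x1 * f2 v + (x2 * f1 v + x3 * M v)) = x3 * n.
  rewrite RintegralD//; last 2 first.
  - exact: integrable_scale.
  - by apply: integrable_add => //; exact: integrable_scale.
  rewrite RintegralD//; try exact: integrable_scale.
  have Z r (g : R -> R) : mu.-integrable setT (EFin \o g) ->
    \int[mu]_v (r * g v) = r * \int[mu]_v g v by move=> ig; exact: RintegralZl.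
  by rewrite (Z _ f2)// (Z _ f1)// (Z _ M)// f10 f20 iM0 !mulr0 !add0r.
apply: ord3_case; rewrite [RHS]mxE /=.
- have := lin 0 0 1; rewrite mul1r => <-; apply: eq_Rintegral => v _.
  by rewrite mxE /=; ring.
- have := lin 0 1 u; rewrite mulrC => <-; apply: eq_Rintegral => v _.
  by rewrite mxE /= /f1; ring.
- have := lin 2^-1 u ((u ^+ 2 + th) / 2); rewrite [X in _ = X -> _]mulrC mulrA => <-.
  apply: eq_Rintegral => v _.
  by rewrite mxE /= /f1 /f2; field.
Qed.

End MaxwellianTheory.

(** * Broken polynomials *)

Section BrokenPolynomials.
Context {R : realType}.
Local Notation mu := (@lebesgue_measure R).
Implicit Types (cells : seq (interval R)) (d : nat) (g : R -> R).

Definition in_cells cells (x : R) : Prop := exists2 I, I \in cells & x \in I.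

Definition bounded_open_cells cells : Prop :=
  forall I, I \in cells -> exists x y, I = `]x, y[.

Lemma broken_poly_out cells d g x : broken_poly cells d g ->
  ~ in_cells cells x -> g x = 0.
Proof.
by move=> [_ g0] xC; apply: g0 => I IC; apply/negP => xI; apply: xC; exists I.
Qed.

Lemma broken_poly0 cells d : broken_poly cells d (fun=> 0).
Proof.
split=> // I _; exists 0; first by rewrite size_poly0.
by move=> x _; rewrite horner0.
Qed.

Lemma broken_polyD cells d g h :
  broken_poly cells d g -> broken_poly cells d h ->
  broken_poly cells d (fun x => g x + h x).
Proof.
move=> [gp g0] [hp h0]; split=> [I IC|x xC]; last by rewrite g0// h0// addr0.
have [p sp pE] := gp _ IC; have [q sq qE] := hp _ IC.
exists (p + q); first by rewrite (leq_trans (size_polyD _ _))// geq_max sp.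
by move=> x xI; rewrite pE// qE// hornerD.
Qed.

Lemma broken_polyZ cells d g (c : R) : broken_poly cells d g ->
  broken_poly cells d (fun x => c * g x).
Proof.
move=> [gp g0]; split=> [I IC|x xC]; last by rewrite g0// mulr0.
have [p sp pE] := gp _ IC.
exists (c *: p); first by rewrite (leq_trans (size_scale_leq _ _)).
by move=> x xI; rewrite pE// hornerZ.
Qed.

Lemma broken_poly_sum cells d (n : nat) (h : 'I_n -> R -> R) :
  (forall i, broken_poly cells d (h i)) ->
  broken_poly cells d (fun x => \sum_(i < n) h i x).
Proof.
elim: n h => [|n IH] h hb.
  rewrite (_ : (fun _ => _) = (fun=> 0)); first exact: broken_poly0.
  by apply/funext => x; rewrite big_ord0.
rewrite (_ : (fun _ => _) = (fun x => h ord0 x + \sum_(i < n) h (lift ord0 i) x)).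
  by apply: broken_polyD => //; exact: IH.
by apply/funext => x; rewrite big_ord_recl.
Qed.

Lemma measurable_broken_poly cells d g : broken_poly cells d g ->
  measurable_fun setT g.
Proof.
move=> gb; have [gp _] := gb.
have UE : measurable [set x | in_cells cells x] /\
    measurable_fun [set x | in_cells cells x] g.
  elim: cells gp {gb} => [_|I cells IH gp].
    rewrite (_ : [set x | _] = set0).
      by split => //; exact: measurable_fun_set0.
    by apply/seteqP; split => // x [].
  have {IH}[|mU mg] := IH.
    by move=> J JC; apply: gp; rewrite inE JC orbT.
  have -> : [set x | in_cells (I :: cells) x] =
      [set` I] `|` [set x | in_cells cells x].
    apply/seteqP; split => x /= => [[J]|[xI|[J JC xJ]]].
    - by rewrite inE => /orP[/eqP ->|JC] xJ; [left|right; exists J].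
    - by exists I; rewrite // mem_head.
    - by exists J; rewrite // inE JC orbT.
  have mI : measurable [set` I] by exact: measurable_itv.
  split; first exact: measurableU.
  apply/measurable_funU => //; split => //.
  have [p _ pE] := gp I (mem_head _ _).
  apply: (eq_measurable_fun (horner p)).
    by move=> x; rewrite inE /= => xI; rewrite pE.
  by apply: measurable_funTS; apply: continuous_measurable_fun; exact: continuous_horner.
have [mU mg] := UE.
rewrite -(setUv [set x | in_cells cells x]).
apply/measurable_funU => //; first exact: measurableC.
split; first exact: mg.
apply: (eq_measurable_fun (fun=> 0 : R)); last exact: measurable_cst.
move=> x; rewrite inE /= => xC; symmetry; exact: broken_poly_out gb xC.
Qed.

(** Each cell provides its own constant; there are finitely many cells, so
    the smallest one serves all of them. *)
Lemma seq_common_bound (T : eqType) (l : seq T) (P : T -> R -> Prop) :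
  (forall i c c', 0 < c' -> c' <= c -> P i c -> P i c') ->
  (forall i, i \in l -> exists2 c : R, 0 < c & P i c) ->
  exists2 c : R, 0 < c & forall i, i \in l -> P i c.
Proof.
move=> Pmono; elim: l => [_|i l IH Pl]; first by exists 1.
have [c c0 Pc] := Pl i (mem_head _ _).
have [|c' c'0 Pc'] := IH; first by move=> j jl; apply: Pl; rewrite inE jl orbT.
have m0 : 0 < Num.min c c' by rewrite lt_min c0.
exists (Num.min c c') => // j; rewrite inE => /orP[/eqP ->|jl].
- by apply: Pmono Pc => //; rewrite ge_min lexx.
- by apply: Pmono (Pc' _ jl) => //; rewrite ge_min lexx orbT.
Qed.

Lemma broken_poly_bounded cells d g : bounded_open_cells cells ->
  broken_poly cells d g -> exists C : R, forall x, `|g x| <= C.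
Proof.
move=> oc gb; have [gp _] := gb.
have [|I IC|c c0 gc] := @seq_common_bound _ cells
    (fun I c => forall x, x \in I -> `|g x| <= c^-1).
- move=> I c c' c'0 c'c gc x xI; rewrite (le_trans (gc x xI))//.
  by rewrite lef_pV2 ?posrE// (lt_le_trans c'0).
- have [p _ pE] := gp _ IC; have [x [y IE]] := oc _ IC.
  have [M MP] := poly_itv_bound p x y.
  have M1 : 0 < Num.max M 1 by rewrite lt_max ltr01 orbT.
  exists (Num.max M 1)^-1; first by rewrite invr_gt0.
  move=> z zI; rewrite invrK pE// le_max MP//.
  by move: zI; rewrite IE in_itv /= => /andP[/ltW -> /ltW ->].
exists c^-1 => x; have [[I IC xI]|xC] := pselect (in_cells cells x).
  exact: gc xI.
by rewrite (broken_poly_out gb xC) normr0 invr_ge0 ltW.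
Qed.

Lemma cvg_at_right_poly (g : R -> R) (p : {poly R}) (x y : R) : x < y ->
  {in `]x, y[, forall z, g z = p.[z]} -> g z @[z --> x^'+] --> p.[x].
Proof.
move=> xy gp; have cp : p.[z] @[z --> x^'+] --> p.[x].
  by apply: cvg_at_right_filter; exact: continuous_horner.
apply: cvg_trans cp; apply: near_eq_cvg; near=> z.
symmetry; apply: gp; rewrite in_itv /=; apply/andP; split => //.
Unshelve. all: by end_near. Qed.

Lemma cvg_at_left_poly (g : R -> R) (p : {poly R}) (x y : R) : x < y ->
  {in `]x, y[, forall z, g z = p.[z]} -> g z @[z --> y^'-] --> p.[y].
Proof.
move=> xy gp; have cp : p.[z] @[z --> y^'-] --> p.[y].
  by apply: cvg_at_left_filter; exact: continuous_horner.
apply: cvg_trans cp; apply: near_eq_cvg; near=> z.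
symmetry; apply: gp; rewrite in_itv /=; apply/andP; split => //.
Unshelve. all: by end_near. Qed.

Lemma broken_poly_derivative cells d g : bounded_open_cells cells ->
  broken_poly cells d g ->
  exists2 g', broken_poly cells d g' &
    forall x, in_cells cells x -> is_derive x 1 g (g' x).
Proof.
move=> oc gb; have [gp _] := gb.
(* Setting the derivative to 0 off the cells selects the representative that
   belongs to the discrete space. *)
pose g' x := if has (fun I : interval R => x \in I) cells then g^`()%classic x else 0.
have dg I p x : I \in cells -> x \in I -> {in I, forall z, g z = p.[z]} ->
    is_derive x (1 : R) g p^`().[x].
  move=> IC xI pE; have [l [r IE]] := oc _ IC; rewrite IE in xI pE.
  apply: (@near_eq_is_derive _ _ _ (horner p)).
  by near=> z; symmetry; apply: pE; near: z; exact: near_in_itvoo.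
have g'E I p x : I \in cells -> x \in I -> {in I, forall z, g z = p.[z]} ->
    g' x = p^`().[x].
  move=> IC xI pE; rewrite /g' ifT; last by apply/hasP; exists I.
  by have D := dg _ _ _ IC xI pE; rewrite derive1E; exact: derive_val.
exists g'.
  split=> [I IC|x xC]; last first.
    by rewrite /g' ifN//; apply/hasPn => I IC; exact: xC.
  have [p sp pE] := gp _ IC; exists p^`(); last by move=> x xI; exact: g'E pE.
  by rewrite (leq_trans (size_poly _ _))// (leq_trans (leq_pred _)).
move=> x [I IC xI]; have [p sp pE] := gp _ IC.
rewrite (g'E I p)//; exact: dg pE.
Unshelve. all: by end_near. Qed.

Lemma broken_poly_continuous cells d g x : bounded_open_cells cells ->
  broken_poly cells d g -> in_cells cells x -> {for x, continuous g}.
Proof.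
move=> oc gb xC; have [g' _ dg] := broken_poly_derivative oc gb.
apply: differentiable_continuous; apply/derivable1_diffP.
by case: (dg x xC).
Qed.

(** If [G] were positive at [x] it would be nonzero on a ball around [x],
    which has positive measure. *)
Lemma Rintegral_ge0_eq0_continuous (a b x : R) (G : R -> R) :
  measurable_fun `]a, b[ G -> (forall y, 0 <= G y) ->
  mu.-integrable `]a, b[ (EFin \o G) ->
  \int[mu]_(y in `]a, b[) G y = 0 -> x \in `]a, b[ ->
  {for x, continuous G} -> G x = 0.
Proof.
move=> mG G0 iG iG0 xab cG; apply/eqP; apply: contrapT => Gx.
move: Gx => /negP Gx0.
have mab : measurable (`]a, b[%classic : set R) by exact: measurable_itv.
have : (\int[mu]_(y in `]a, b[) `|(EFin \o G) y| = 0)%E.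
  rewrite -[RHS]/(0%:E) -iG0 /Rintegral fineK; last exact: integrable_fin_num.
  by apply: eq_integral => y _ /=; rewrite ger0_norm.
move=> /(ae_eq_integral_abs mu mab).
have mG' : measurable_fun `]a, b[ (EFin \o G) by exact/measurable_EFinP.
move=> /(_ mG') [N [mN N0 subN]].
have : \forall y \near x, N y.
  near=> y; apply: subN => /=; apply/not_implyP; split.
    rewrite in_itv /=. near: y. exact: (near_in_itvoo xab).
  move=> [Gy]; move: Gy; apply/eqP. near: y.
  exact: (cvgr_neq0 _ cG).
move=> /nbhs_ballP[e /= e0 eN].
have : (mu (ball x e) <= mu N)%E by apply: le_measure; rewrite ?inE//; exact: measurable_ball.
rewrite N0 lebesgue_measure_ball ?(ltW e0)// lee_fin leNgt.
by rewrite mulrn_wgt0.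
Unshelve. all: by end_near. Qed.

End BrokenPolynomials.

(** * Cells, nodes and traces *)

Section Mesh.
Context {R : realType}.
Local Notation mu := (@lebesgue_measure R).
Implicit Types (a b x : R) (s : seq R) (eta q : R -> 'rV[R]_3).

Lemma xcellsP a s I : path <%R a s -> I \in xcells a s ->
  exists x y, [/\ I = `]x, y[, x < y, x \in belast a s, y \in s &
    a <= x /\ y <= last a s].
Proof.
elim: s a => [//|c s IH] a /= /andP[ac cs].
have cl z : z \in c :: s -> z <= last c s.
  elim: s {IH} c ac cs z => [|e s IH] c ac cs z; first by rewrite inE => /eqP ->.
  move: cs => /= /andP[ce es]; rewrite inE => /orP[/eqP ->|].
    by rewrite (le_trans (ltW ce))// IH ?mem_head// (lt_trans ac).
  by apply: IH => //; exact: lt_trans ce.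
rewrite inE => /orP[/eqP ->|/(IH _ cs)[x [y [-> xy xb ys [cx yl]]]]].
  by exists a, c; split; rewrite ?mem_head//; split => //; apply: cl; rewrite mem_head.
exists x, y; split; rewrite // ?inE ?xb ?ys ?orbT//.
by split => //; exact: le_trans (ltW ac) cx.
Qed.

Lemma bounded_open_xcells a s : path <%R a s -> bounded_open_cells (xcells a s).
Proof. by move=> ps I /(xcellsP ps)[x [y [-> *]]]; exists x, y. Qed.

Lemma in_cells_itv a b s x : itv_partition a b s -> in_cells (xcells a s) x ->
  x \in `]a, b[.
Proof.
move=> [ps /eqP lb] [I /(xcellsP ps)[l [r [-> lr _ _ [al]]]]].
rewrite lb => rb; rewrite !in_itv /= => /andP[lx xr].
by rewrite (le_lt_trans al)// (lt_le_trans xr).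
Qed.

Lemma right_cell a s x : path <%R a s -> x \in belast a s ->
  exists2 y, x < y & `]x, y[ \in xcells a s.
Proof.
elim: s a => [//|c s IH] a /= /andP[ac cs].
rewrite inE => /orP[/eqP ->|/(IH _ cs)[y xy yC]].
  by exists c => //; rewrite mem_head.
by exists y => //; rewrite inE yC orbT.
Qed.

Lemma left_cell a s y : path <%R a s -> y \in s ->
  exists2 x, x < y & `]x, y[ \in xcells a s.
Proof.
elim: s a => [//|c s IH] a /= /andP[ac cs].
rewrite inE => /orP[/eqP ->|/(IH _ cs)[x xy xC]].
  by exists a => //; rewrite mem_head.
by exists x => //; rewrite inE xC orbT.
Qed.

Lemma cells_cover a s x : path <%R a s -> a < x -> x <= last a s ->
  in_cells (xcells a s) x \/ x \in s.
Proof.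
elim: s a => [|c s IH] a /=.
  by move=> _ ax xa; move: (lt_le_trans ax xa); rewrite ltxx.
move=> /andP[ac cs] ax xl; have [xc|cx|->] := ltgtP x c.
- by left; exists `]a, c[; rewrite ?mem_head// in_itv /= ax.
- have [[I IC xI]|xs] := IH _ cs cx xl.
    by left; exists I; rewrite // inE IC orbT.
  by right; rewrite inE xs orbT.
- by right; rewrite mem_head.
Qed.

Lemma interior_node a s x : x \in behead (belast a s) ->
  x \in belast a s /\ x \in s.
Proof.
case: s => [//|c s] /= xs; split; first by rewrite inE xs orbT.
exact: mem_belast xs.
Qed.

Definition rtrace (w : R -> 'rV[R]_3) (x : R) : 'rV[R]_3 :=
  \row_k lim (w y 0 k @[y --> x^'+]).

Definition ltrace (w : R -> 'rV[R]_3) (x : R) : 'rV[R]_3 :=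
  \row_k lim (w y 0 k @[y --> x^'-]).

Lemma Vx_cvg_right a s kappa g x : path <%R a s -> Vx a s kappa g ->
  x \in belast a s -> cvg (g y @[y --> x^'+]).
Proof.
move=> ps [gp _] xs; have [y xy yC] := right_cell ps xs.
have [p _ pE] := gp _ yC; apply/cvg_ex; exists p.[x].
exact: cvg_at_right_poly xy pE.
Qed.

Lemma Vx_cvg_left a s kappa g x : path <%R a s -> Vx a s kappa g ->
  x \in s -> cvg (g y @[y --> x^'-]).
Proof.
move=> ps [gp _] xs; have [y xy yC] := left_cell ps xs.
have [p _ pE] := gp _ yC; apply/cvg_ex; exists p.[x].
exact: cvg_at_left_poly xy pE.
Qed.

Lemma rtrace_cvg a s kappa eta x k : path <%R a s -> Vx3 a s kappa eta ->
  x \in belast a s -> eta y 0 k @[y --> x^'+] --> rtrace eta x 0 k.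
Proof. by move=> ps eV xs; rewrite mxE; exact: (Vx_cvg_right ps (eV k) xs). Qed.

Lemma ltrace_cvg a s kappa eta x k : path <%R a s -> Vx3 a s kappa eta ->
  x \in s -> eta y 0 k @[y --> x^'-] --> ltrace eta x 0 k.
Proof. by move=> ps eV xs; rewrite mxE; exact: (Vx_cvg_left ps (eV k) xs). Qed.

(** Quantitative form of [realizable_field]. *)
Definition field_realizable_with (c : R) a s eta : Prop :=
  [/\ forall x, in_cells (xcells a s) x -> realizable_with c (eta x),
      forall x, x \in belast a s -> realizable_with c (rtrace eta x) &
      forall x, x \in s -> realizable_with c (ltrace eta x)].

(** Density and discriminant are positive polynomials on a compact segment. *)
Lemma realizable_segment (P : R -> 'rV[R]_3) (p : 'I_3 -> {poly R}) (x y : R) :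
  x <= y -> (forall z k, P z 0 k = (p k).[z]) ->
  (forall z, z \in `[x, y] -> realizable (P z)) ->
  exists2 c, 0 < c & forall z, z \in `[x, y] -> realizable_with c (P z).
Proof.
move=> xy PE PR.
have Pp (z : R) : P z = \row_k (p k).[z] by apply/rowP => k; rewrite PE mxE.
pose D : {poly R} := 2 *: (p 0 * p 2%:R) - p 1 ^+ 2.
have DE z : discriminant (P z) = D.[z].
  rewrite /discriminant !PE /D hornerD hornerN hornerZ hornerM.
  by rewrite horner_exp mulrA.
have [z0 z0xy z0min] := EVT_min xy (continuous_subspaceT (@continuous_horner _ (p 0))).
have [z1 z1xy z1min] := EVT_min xy (continuous_subspaceT (@continuous_horner _ D)).
have n0 : 0 < (p 0).[z0].
  by have /realizableP[+ _] := PR _ z0xy; rewrite PE.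
have d0 : 0 < D.[z1].
  by have /realizableP[_ +] := PR _ z1xy; rewrite DE.
have [C C0 CP] : exists2 C : R, 0 < C & forall k z, z \in `[x, y] -> `|(p k).[z]| <= C.
  have B k := poly_itv_bound (p k) x y.
  pose M : R := 1 + \sum_(k < 3) `|sval (B k)|.
  exists M; first by rewrite ltr_pwDl// sumr_ge0.
  have kM k z : z \in `[x, y] -> `|(p k).[z]| <= `|sval (B k)|.
    by rewrite in_itv /= => zxy; apply: le_trans (svalP (B k) z zxy) (ler_norm _).
  move=> k z /kM/le_trans; apply.
  by rewrite /M (bigD1 k)//= addrCA lerDl addr_ge0// sumr_ge0.
pose c := Num.min (p 0).[z0] (Num.min D.[z1] C^-1).
have c0 : 0 < c by rewrite !lt_min n0 d0 invr_gt0.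
exists c => // z zxy; split.
- by rewrite PE (le_trans _ (z0min _ zxy))// ge_min lexx.
- by rewrite DE (le_trans _ (z1min _ zxy))// !ge_min lexx orbT.
- move=> k; rewrite PE (le_trans (CP k z zxy))// -[C]invrK.
  by rewrite lef_pV2 ?posrE ?invr_gt0// !ge_min lexx !orbT.
Qed.

(** An open cell is not compact: the argument runs on the closed cell, where
    the polynomial that represents the field takes the traces as end values, so
    it is realizability of the traces that supplies the end points. *)
Lemma realizable_field_with a s kappa eta : path <%R a s ->
  Vx3 a s kappa eta -> realizable_field a s eta ->
  exists2 c, 0 < c & field_realizable_with c a s eta.
Proof.
move=> ps eV [eC eR eL].
have [||c c0 cP] := @seq_common_bound _ _ (xcells a s)
  (fun I c => forall x y, I = `]x, y[ -> x < y -> x \in belast a s -> y \in s ->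
   [/\ forall z, z \in I -> realizable_with c (eta z),
       realizable_with c (rtrace eta x) & realizable_with c (ltrace eta y)]).
- move=> I c c' c'0 c'c H x y IE xy xs ys; have [H1 H2 H3] := H x y IE xy xs ys.
  by split => [z /H1 ?||]; exact: (realizable_with_le (c := c)).
- move=> I IC; have [x [y [IE xy xs ys _]]] := xcellsP ps IC.
  have H k : exists p : {poly R}, {in `]x, y[, forall z, eta z 0 k = p.[z]}.
    by have [/(_ _ IC)[p _ pE] _] := eV k; exists p; rewrite -IE.
  have [p pE] := choice H.
  (* The polynomial extension of the field to the closed cell. *)
  pose P z : 'rV[R]_3 := \row_k (p k).[z].
  have etaP z : z \in I -> eta z = P z.
    by rewrite IE => zI; apply/rowP => k; rewrite mxE pE.
  have rP : rtrace eta x = P x.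
    by apply/rowP => k; rewrite !mxE; apply/cvg_lim => //; exact: cvg_at_right_poly (pE k).
  have lP : ltrace eta y = P y.
    by apply/rowP => k; rewrite !mxE; apply/cvg_lim => //; exact: cvg_at_left_poly (pE k).
  have [||z|c c0 cP] := realizable_segment (P := P) (p := p) (x := x) (y := y).
  + exact: ltW.
  + by move=> z k; rewrite mxE.
  + rewrite in_itv /= !le_eqVlt => /andP[/orP[/eqP <- _|xz]].
      by rewrite -rP; exact: eR.
    move=> /orP[/eqP ->|zy]; first by rewrite -lP; exact: eL.
    have zI : z \in I by rewrite IE in_itv /= xz.
    by rewrite -etaP//; exact: eC zI.
  exists c => // x' y' IE' _ _ _.
  have [<- <-] : x = x' /\ y = y' by move: IE'; rewrite IE => -[].
  rewrite rP lP; split.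
  + move=> z zI; rewrite etaP//; apply: cP.
    by move: zI; rewrite IE !in_itv /= => /andP[/ltW -> /ltW ->].
  + by apply: cP; rewrite in_itv /= lexx ltW.
  + by apply: cP; rewrite in_itv /= lexx ltW.
exists c => //; split.
- move=> x [I IC xI]; have [l [r [IE lr ls rs _]]] := xcellsP ps IC.
  by have [+ _ _] := cP _ IC _ _ IE lr ls rs; exact.
- move=> x xs; have [y xy IC] := right_cell ps xs.
  have [l [r [IE lr ls rs _]]] := xcellsP ps IC.
  have [-> _] : x = l /\ y = r by move: IE => -[].
  by have [_ + _] := cP _ IC _ _ IE lr ls rs.
- move=> y ys; have [x xy IC] := left_cell ps ys.
  have [l [r [IE lr ls rs _]]] := xcellsP ps IC.
  have [_ ->] : x = l /\ y = r by move: IE => -[].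
  by have [_ _] := cP _ IC _ _ IE lr ls rs.
Qed.

End Mesh.

(** * Pairing kinetic functions with moment test functions *)

Section Pairing.
Context {R : realType}.
Local Notation mu := (@lebesgue_measure R).
Implicit Types (a b x : R) (s : seq R) (eta q : R -> 'rV[R]_3).

Lemma integrable_tensor (u v : R -> R) :
  mu.-integrable setT (EFin \o u) -> mu.-integrable setT (EFin \o v) ->
  (mu \x mu)%E.-integrable setT (EFin \o (fun p : R * R => u p.1 * v p.2)).
Proof.
move=> iu iv.
have mu_ : measurable_fun setT u by apply/measurable_EFinP; exact: measurable_int iu.
have mv_ : measurable_fun setT v by apply/measurable_EFinP; exact: measurable_int iv.
apply/integrable12ltyP.
  apply/measurable_EFinP; apply: measurable_funM.
    exact: (measurableT_comp mu_ measurable_fst).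
  exact: (measurableT_comp mv_ measurable_snd).
have [_ fu] := integrableP _ _ _ iu.
have [_ fv] := integrableP _ _ _ iv.
under eq_integral => x _.
  under eq_integral => y _.
    rewrite /= normrM EFinM.
    over.
  rewrite ge0_integralZl//; last first.
    by apply/measurable_EFinP; exact: measurableT_comp.
  over.
have fvn : (\int[mu]_y `|v y|%:E)%E \is a fin_num.
  rewrite ge0_fin_numE//; by apply: integral_ge0 => y _; rewrite lee_fin.
rewrite /= -(fineK fvn) ge0_integralZr//.
- rewrite muleC; apply: lte_mul_pinfty => //.
  by rewrite lee_fin fine_ge0//; apply: integral_ge0 => y _; rewrite lee_fin.
- by apply/measurable_EFinP; exact: measurableT_comp.
- by rewrite lee_fin fine_ge0//; apply: integral_ge0 => y _; rewrite lee_fin.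
Qed.

(** Bounded in [x] and dominated by a Gaussian in [v]: the dominating function
    is a tensor product of integrable functions. *)
Lemma integrable_slab a b (K delta : R) (w : R * R -> R) :
  0 < delta -> measurable_fun setT w ->
  (forall p, `|w p| <= K * gauss delta p.2) ->
  (mu \x mu)%E.-integrable (`]a, b[ `*` setT) (EFin \o w).
Proof.
move=> d0 mw wK.
have mab : measurable (`]a, b[%classic : set R) by exact: measurable_itv.
have mD : measurable (`]a, b[ `*` setT : set (R * R)) by exact: measurableX.
pose g (p : R * R) := \1_(`]a, b[) p.1 * (K * gauss delta p.2).
apply: (@bounded_by_integrable _ _ _ (mu \x mu)%E _ w g) => //.
- exact: measurable_funTS.
- apply: (integrableS measurableT) => //.
  apply: (integrable_tensor (u := \1_(`]a, b[)) (v := fun v => K * gauss delta v)).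
    apply: integrable_indic_itv.
  by apply: integrable_scale => //; exact: integrable_gauss.
- by move=> p [pab _]; rewrite /g indicE mem_set// mul1r.
Qed.

Lemma Rintegral_slab a b (K delta : R) (w : R * R -> R) :
  0 < delta -> measurable_fun setT w ->
  (forall p, `|w p| <= K * gauss delta p.2) ->
  \int[(mu \x mu)%E]_(p in `]a, b[ `*` setT) w p =
  \int[mu]_(x in `]a, b[) \int[mu]_v w (x, v).
Proof.
move=> d0 mw wK; have iw := integrable_slab a b d0 mw wK.
have mab : measurable (`]a, b[%classic : set R) by exact: measurable_itv.
have mD : measurable (`]a, b[ `*` setT : set (R * R)) by exact: measurableX.
rewrite /Rintegral; congr fine.
rewrite integral_mkcond -integral12_prod_meas1; last first.
  by rewrite -integrable_mkcond.
rewrite [RHS]integral_mkcond; apply: eq_integral => x _.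
rewrite /fubini_F patchE; case: ifPn => [/set_mem xab|xab].
  rewrite fineK.
    by apply: eq_integral => v _; rewrite patchE mem_set.
  apply: integrable_fin_num => //.
  apply: (gauss_bounded_integrable (K := K) (delta := delta) (w := fun v => w (x, v))) => //.
  exact: measurableT_comp.
apply: integral0_eq => v _; rewrite patchE memNset// => -[/= xab' _].
by move/negP: xab; apply; rewrite inE.
Qed.

Lemma measurable_edot q : (forall k, measurable_fun setT (fun x => q x 0 k)) ->
  measurable_fun setT (edot q).
Proof.
move=> mq; rewrite /edot; apply: measurable_sum => k; apply: measurable_funM.
  exact: (measurableT_comp (measurable_evec k) measurable_snd).
exact: (measurableT_comp (mq k) measurable_fst).
Qed.

Lemma edot_le_expR q : (forall k, exists C : R, forall x, `|q x 0 k| <= C) ->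
  exists2 Q : R, 0 <= Q & forall p, `|edot q p| <= Q * expR (2 * `|p.2|).
Proof.
move=> qb; have [C CP] := choice qb.
have C0 k : 0 <= C k by exact: le_trans (normr_ge0 (q 0 0 k)) _.
exists (\sum_(k < 3) C k); first by rewrite sumr_ge0.
move=> p; rewrite mulr_suml; apply: (le_trans (ler_norm_sum _ _ _)).
apply: ler_sum => k _; rewrite normrM mulrC ler_pM//; exact: evec_le_expR.
Qed.

Lemma moment_integrable (K delta : R) (w : R * R -> R) x k :
  0 < delta -> measurable_fun setT w ->
  (forall p, `|w p| <= K * gauss delta p.2) ->
  mu.-integrable setT (EFin \o (fun v => evec v 0 k * w (x, v))).
Proof.
move=> d0 mw wK.
apply: (expR_gauss_bounded_integrable (C := 1) (K := K) (delta := delta) (m := 2)) => //.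
- exact: measurable_evec.
- exact: measurableT_comp.
- by move=> v _; rewrite mul1r; exact: evec_le_expR.
Qed.

(** By Fubini the inner integral over [v] of [w] times e_k is the k-th moment. *)
Lemma ipxv_edot a b (K delta : R) (w : R * R -> R) q :
  0 < delta -> measurable_fun setT w ->
  (forall p, `|w p| <= K * gauss delta p.2) ->
  (forall k, measurable_fun setT (fun x => q x 0 k)) ->
  (forall k, exists C : R, forall x, `|q x 0 k| <= C) ->
  ipxv a b w (edot q) = ipx a b (moments w) q.
Proof.
move=> d0 mw wK mq qb; have [Q Q0 QP] := edot_le_expR qb.
have iev x k := moment_integrable (w := w) x k d0 mw wK.
rewrite /ipxv (Rintegral_slab a b (delta := delta / 2)
  (K := Q * K * expR (2 ^+ 2 / (2 * delta)))).
- apply: eq_Rintegral => x _.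
  transitivity (\int[mu]_v \sum_(k < 3) (q x 0 k * (evec v 0 k * w (x, v)))).
    apply: eq_Rintegral => v _; rewrite /edot mulr_sumr; apply: eq_bigr => k _.
    by rewrite /=; ring.
  rewrite Rintegral_sum//; last by move=> k; exact: integrable_scale.
  apply: eq_bigr => k _; rewrite mxE mulrC.
  exact: (RintegralZl _ measurableT (iev x k)).
- by rewrite divr_gt0.
- by apply: measurable_funM => //; exact: measurable_edot.
- move=> p; rewrite mulrC; exact: expR_mul_gauss_le (wK p) (QP p).
Qed.

Lemma in_cells_bounded (cells : seq (interval R)) : bounded_open_cells cells ->
  exists2 V : R, 0 < V & forall v, in_cells cells v -> `|v| <= V.
Proof.
move=> oc; have [||c c0 cP] := @seq_common_bound R _ cells
  (fun I c => forall v, v \in I -> `|v| <= c^-1).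
- move=> I c c' c'0 c'c H v vI; rewrite (le_trans (H v vI))//.
  by rewrite lef_pV2 ?posrE// (lt_le_trans c'0).
- move=> I /oc[x [y ->]].
  have m0 : 0 < Num.max 1 (Num.max (- x) y) by rewrite lt_max ltr01.
  exists (Num.max 1 (Num.max (- x) y))^-1; first by rewrite invr_gt0.
  move=> v; rewrite in_itv /= => /andP[xv vy]; rewrite invrK ler_norml.
  by rewrite lerNl !le_max lerN2 (ltW xv) (ltW vy) !orbT.
by exists c^-1; [rewrite invr_gt0|move=> v [I IC vI]; exact: cP vI].
Qed.

Lemma bounded_open_vcells (vmax : R) Nv : bounded_open_cells (vcells vmax Nv).
Proof. by move=> I /mapP[j _ ->]; exists (vnode vmax Nv j), (vnode vmax Nv j.+1). Qed.

Lemma measurable_Vh a s kappa vmax Nv f : Vh a s kappa vmax Nv f -> measurable_fun setT f.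
Proof.
move=> [m [phi [psi [H ->]]]]; apply: measurable_sum => i.
have [ph ps'] := H i; apply: measurable_funM.
  exact: (measurableT_comp (measurable_broken_poly ph) measurable_fst).
exact: (measurableT_comp (measurable_broken_poly ps') measurable_snd).
Qed.

Lemma Vh_out a s kappa vmax Nv f x v : Vh a s kappa vmax Nv f ->
  ~ in_cells (vcells vmax Nv) v -> f (x, v) = 0.
Proof.
move=> [m [phi [psi [H ->]]]] vC; rewrite big1// => i _ /=.
by rewrite (broken_poly_out (H i).2 vC) mulr0.
Qed.

(** Turns a bound on a function that vanishes off the velocity grid into a
    Gaussian bound, the form in which Maxwellians are bounded too. *)
Lemma compact_velocity_gauss (vmax : R) Nv : exists2 V : R, 0 < V &
  forall v, in_cells (vcells vmax Nv) v -> 1 <= expR (V ^+ 2) * gauss 1 v.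
Proof.
have [V V0 VP] := in_cells_bounded (@bounded_open_vcells vmax Nv).
exists V => // v /VP vV; rewrite /gauss mul1r -expRD.
rewrite -[leLHS]expR0 ler_expR subr_ge0.
by rewrite -[v ^+ 2]real_normK ?num_real// ler_pXn2r ?nnegrE// ltW.
Qed.

Lemma Vh_le_gauss a s kappa vmax Nv f : path <%R a s ->
  Vh a s kappa vmax Nv f ->
  exists K : R, forall p, `|f p| <= K * gauss 1 p.2.
Proof.
move=> ps fV; have [V V0 VP] := compact_velocity_gauss vmax Nv.
have [C [C0 CP]] : exists C : R, 0 <= C /\ forall p, `|f p| <= C.
  move: fV => [m [phi [psi [H ->]]]].
  have bphi i := broken_poly_bounded (bounded_open_xcells ps) (H i).1.
  have bpsi i := broken_poly_bounded (@bounded_open_vcells vmax Nv) (H i).2.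
  have [A AP] := choice bphi; have [B BP] := choice bpsi.
  exists (\sum_(i < m) A i * B i); split.
    rewrite sumr_ge0// => i _; rewrite mulr_ge0//.
      exact: le_trans (normr_ge0 (phi i 0)) _.
    exact: le_trans (normr_ge0 (psi i 0)) _.
  move=> p; apply: (le_trans (ler_norm_sum _ _ _)); apply: ler_sum => i _.
  by rewrite normrM ler_pM.
exists (C * expR (V ^+ 2)) => -[x v].
have [vC|vC] := pselect (in_cells (vcells vmax Nv) v).
  by rewrite (le_trans (CP _))// -mulrA ler_peMr//; exact: VP.
by rewrite (Vh_out _ fV vC) normr0 !mulr_ge0 ?expR_ge0.
Qed.

Lemma moments_Vh a s kappa vmax Nv f : Vh a s kappa vmax Nv f -> Vx3 a s kappa (moments f).
Proof.
move=> [m [phi [psi [H fE]]]] k.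
have ipsi i : mu.-integrable setT (EFin \o (fun v => evec v 0 k * psi i v)).
  have [C CP] := broken_poly_bounded (@bounded_open_vcells vmax Nv) (H i).2.
  have [V V0 VP] := compact_velocity_gauss vmax Nv.
  have C0 : 0 <= C by exact: le_trans (normr_ge0 (psi i 0)) _.
  apply: (expR_gauss_bounded_integrable (C := 1) (K := C * expR (V ^+ 2)) (delta := 1) (m
    := 2)) => //.
  - exact: measurable_evec.
  - exact: measurable_broken_poly (H i).2.
  - by move=> v _; rewrite mul1r; exact: evec_le_expR.
  - move=> v _; have [vC|vC] := pselect (in_cells (vcells vmax Nv) v).
      by rewrite (le_trans (CP _))// -mulrA ler_peMr//; exact: VP.
    by rewrite (broken_poly_out (H i).2 vC) normr0 !mulr_ge0 ?expR_ge0.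
pose c i := \int[mu]_v (evec v 0 k * psi i v).
rewrite (_ : (fun x => _) = (fun x => \sum_(i < m) (c i * phi i x))).
  by apply: broken_poly_sum => i; apply: broken_polyZ; exact: (H i).1.
apply/funext => x; rewrite mxE fE /=.
transitivity (\int[mu]_v \sum_(i < m) (phi i x * (evec v 0 k * psi i v))).
  apply: eq_Rintegral => v _; rewrite mulr_sumr; apply: eq_bigr => i _.
  by rewrite /=; ring.
rewrite Rintegral_sum//; last by move=> i; exact: integrable_scale.
by apply: eq_bigr => i _; rewrite [RHS]mulrC; exact: RintegralZl.
Qed.

Lemma uniform_cvg_dist_le (T : choiceType) (V : normedModType R) (u : nat -> T -> V)
    (l : T -> V) : {uniform, u @ \oo --> l} ->
  forall e : R, 0 < e -> \forall n \near \oo, forall t, `|u n t - l t| <= e.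
Proof.
move=> ul e e0.
have := ul [set g : T -> V | forall t, `|g t - l t| <= e]; apply => /=.
apply/uniform_nbhs; exists [set xy : V * V | `|xy.2 - xy.1| <= e]; split => //.
  rewrite -entourage_ballE; exists e => //= -[x y] /=.
  by rewrite -ball_normE /ball_ /= distrC; exact: ltW.
by move=> h H t; exact: H.
Qed.

(** Integrating a uniformly small function over an unbounded range would
    lose control; the velocity grid confines the integral to a bounded range. *)
Lemma moments_uniform_cvg a s kappa vmax Nv (f : nat -> R * R -> R)
    (fs : R * R -> R) : path <%R a s ->
  (forall n, Vh a s kappa vmax Nv (f n)) -> Vh a s kappa vmax Nv fs ->
  (forall e : R, 0 < e -> \forall n \near \oo, forall p, `|f n p - fs p| <= e) ->
  forall e : R, 0 < e -> \forall n \near \oo,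
    forall x k, `|moments (f n) x 0 k - moments fs x 0 k| <= e.
Proof.
move=> ps fV fsV fl e e0; have [V V0 VP] := compact_velocity_gauss vmax Nv.
pose B := expR (V ^+ 2) * expR (2 ^+ 2 / (2 * 1)).
pose G := \int[mu]_v gauss (1 / 2) v.
have iG : mu.-integrable setT (EFin \o gauss (1 / 2)).
  by apply: integrable_gauss => //; rewrite divr_gt0.
have G0 : 0 <= G by apply: Rintegral_ge0 => v _; exact: gauss_ge0.
have B0 : 0 < B by rewrite mulr_gt0 ?expR_gt0.
have BG0 : 0 < B * G + 1 by rewrite ltr_wpDl ?mulr_ge0 ?(ltW B0).
have := fl _ (divr_gt0 e0 BG0); apply: filterS => n fn x k.
set e' := e / _ in fn.
have e'0 : 0 < e' by exact: divr_gt0.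
have iev g : Vh a s kappa vmax Nv g ->
    mu.-integrable setT (EFin \o (fun v => evec v 0 k * g (x, v))).
  move=> gV; have [K KP] := Vh_le_gauss ps gV.
  by apply: moment_integrable KP => //; exact: measurable_Vh gV.
rewrite !mxE -RintegralB//; [|exact: iev|exact: iev].
have dB v : `|evec v 0 k * f n (x, v) - evec v 0 k * fs (x, v)| <=
    e' * B * gauss (1 / 2) v.
  rewrite -mulrBr.
  have -> : e' * B = 1 * (e' * expR (V ^+ 2)) * expR (2 ^+ 2 / (2 * 1)).
    by rewrite /B; ring.
  apply: expR_mul_gauss_le; last by rewrite mul1r; exact: evec_le_expR.
    by [].
  have [vC|vC] := pselect (in_cells (vcells vmax Nv) v).
    by rewrite (le_trans (fn _))// -mulrA ler_peMr ?(ltW e'0)//; exact: VP.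
  rewrite (Vh_out x (fV n) vC) (Vh_out x fsV vC) subrr normr0.
  apply: mulr_ge0; last exact: gauss_ge0.
  by apply: mulr_ge0; [exact: ltW|exact: expR_ge0].
have id : mu.-integrable setT
    (EFin \o (fun v => evec v 0 k * f n (x, v) - evec v 0 k * fs (x, v))).
  exact: eq_integrable (integrableB measurableT (iev _ (fV n)) (iev _ fsV)).
apply: (le_trans (le_normr_Rintegral _ _)) => //.
apply: (@le_trans _ _ (\int[mu]_v (e' * B * gauss (1 / 2) v))).
  apply: le_Rintegral => //.
  - exact: integrable_norm.
  - exact: integrable_scale.
rewrite RintegralZl// -/G -mulrA /e' mulrAC ler_pdivrMr//.
by rewrite ler_wpM2l ?(ltW e0)// lerDl.
Qed.

Lemma Vx3_measurable a s kappa eta : Vx3 a s kappa eta ->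
  forall k, measurable_fun setT (fun x => eta x 0 k).
Proof. by move=> eV k; exact: measurable_broken_poly (eV k). Qed.

Lemma Vx3_bounded a s kappa eta : path <%R a s -> Vx3 a s kappa eta ->
  forall k, exists C : R, forall x, `|eta x 0 k| <= C.
Proof.
by move=> ps eV k; exact: broken_poly_bounded (bounded_open_xcells ps) (eV k).
Qed.

Lemma Vx3_out a s kappa eta x : Vx3 a s kappa eta ->
  ~ in_cells (xcells a s) x -> eta x = 0.
Proof.
by move=> eV xC; apply/rowP => k; rewrite mxE; exact: broken_poly_out (eV k) xC.
Qed.

Lemma measurable_Maxw a s kappa eta : Vx3 a s kappa eta ->
  measurable_fun setT (Maxw eta).
Proof.
move=> eV; apply: measurable_maxwellian; last exact: measurable_snd.
move=> k; exact: (measurableT_comp (Vx3_measurable eV k) measurable_fst).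
Qed.

Lemma Maxw_le_gauss (c : R) a s : 0 < c ->
  exists K delta : R, 0 < delta /\
    forall kappa eta, Vx3 a s kappa eta -> field_realizable_with c a s eta ->
    forall p, `|Maxw eta p| <= K * gauss delta p.2.
Proof.
move=> c0; have [K [delta [d0 KP]]] := maxwellian_le_gauss c0.
exists `|K|, delta; split => // kappa eta eV [H _ _] [x v].
have [xC|xC] := pselect (in_cells (xcells a s) x).
  rewrite (le_trans (KP _ v (H x xC)))// ler_wpM2r ?gauss_ge0//.
  exact: ler_norm.
rewrite /Maxw /= (Vx3_out eV xC) maxwellian0 normr0 mulr_ge0//.
exact: gauss_ge0.
Qed.

Lemma moments_Maxw a s kappa eta : Vx3 a s kappa eta ->
  (forall x, in_cells (xcells a s) x -> realizable (eta x)) ->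
  moments (Maxw eta) = eta.
Proof.
move=> eV eR; apply/funext => x; apply/rowP => k; rewrite mxE /Maxw /=.
have [xC|xC] := pselect (in_cells (xcells a s) x).
  exact: maxwellian_moments (eR _ xC) k.
rewrite (Vx3_out eV xC) mxE /Rintegral integral0_eq// => v _.
by rewrite maxwellian0 mulr0.
Qed.

End Pairing.

(** * Limits of pairings and of Maxwellian integrals *)

Section Continuity.
Context {R : realType}.
Local Notation mu := (@lebesgue_measure R).
Implicit Types (a b x : R) (s : seq R) (eta q : R -> 'rV[R]_3) (u : 'rV[R]_3).

Lemma cvg_sum_seq {T : Type} {F : set_system T} {FF : Filter F} (I : eqType)
    (r : seq I) (h : T -> I -> R) (l : I -> R) :
  (forall i, i \in r -> h t i @[t --> F] --> l i) ->
  (\sum_(i <- r) h t i) @[t --> F] --> \sum_(i <- r) l i.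
Proof.
elim: r => [_|i r IH H].
  rewrite big_nil; under eq_fun do rewrite big_nil; exact: cvg_cst.
rewrite big_cons; under eq_fun do rewrite big_cons; apply: cvgD.
  by apply: H; rewrite mem_head.
by apply: IH => j jr; apply: H; rewrite inE jr orbT.
Qed.

Lemma bounded_itv_integrable a b (f : R -> R) (C : R) :
  measurable_fun setT f -> (forall x, `|f x| <= C) ->
  mu.-integrable `]a, b[ (EFin \o f).
Proof.
move=> mf fC; apply: measurable_bounded_integrable => //.
- by rewrite /= lebesgue_measure_itv /=; case: ifP => _; rewrite ?ltry// -EFinB ltry.
- exact: measurable_funTS.
- exists C; split; first exact: num_real.
  by move=> M CM x _ /=; rewrite (le_trans (fC x))// ltW.
Qed.

Lemma Vx3_dot_integrable a b s kappa eta q : path <%R a s ->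
  Vx3 a s kappa eta -> Vx3 a s kappa q ->
  mu.-integrable `]a, b[ (EFin \o (fun x => \sum_(k < 3) eta x 0 k * q x 0 k)).
Proof.
move=> ps eV qV.
have [A AP] := choice (Vx3_bounded ps eV).
have [B BP] := choice (Vx3_bounded ps qV).
apply: (bounded_itv_integrable _ _ (C := \sum_(k < 3) A k * B k)).
  apply: measurable_sum => k.
  by apply: measurable_funM; apply: Vx3_measurable; eassumption.
move=> x; apply: (le_trans (ler_norm_sum _ _ _)); apply: ler_sum => k _.
by rewrite normrM ler_pM.
Qed.

(** Testing with the difference of the two fields shows that it vanishes
    inside the cells, by continuity; elsewhere both fields are 0. *)
Lemma Vx3_ipx_inj a b s kappa eta1 eta2 : itv_partition a b s ->
  Vx3 a s kappa eta1 -> Vx3 a s kappa eta2 ->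
  (forall q, Vx3 a s kappa q -> ipx a b eta1 q = ipx a b eta2 q) ->
  eta1 = eta2.
Proof.
move=> hs V1 V2 H; have [ps _] := hs.
pose g x : 'rV[R]_3 := eta1 x - eta2 x.
have gV : Vx3 a s kappa g.
  move=> k; rewrite (_ : (fun x => _) = (fun x => eta1 x 0 k + -1 * eta2 x 0 k)).
    apply: broken_polyD; first exact: (V1 k).
    apply: broken_polyZ; exact: (V2 k).
  by apply/funext => x; rewrite !mxE mulN1r.
have oc := bounded_open_xcells ps.
have gg : \int[mu]_(x in `]a, b[) (\sum_(k < 3) g x 0 k * g x 0 k) = 0.
  have := H g gV => /eqP; rewrite -subr_eq0 => /eqP; rewrite /ipx -RintegralB//.
  - move=> E; rewrite -[RHS]E; apply: eq_Rintegral => x _; rewrite -sumrB.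
    by apply: eq_bigr => k _; rewrite !mxE; ring.
  - exact: Vx3_dot_integrable gV.
  - exact: Vx3_dot_integrable gV.
have sq0 y : 0 <= \sum_(k < 3) g y 0 k * g y 0 k.
  by apply: sumr_ge0 => k _; rewrite -expr2 sqr_ge0.
apply/funext => x; apply/eqP; rewrite -subr_eq0; apply/eqP; rewrite -/(g x).
have [xC|xC] := pselect (in_cells (xcells a s) x); last exact: Vx3_out gV xC.
have G0 : \sum_(k < 3) g x 0 k * g x 0 k = 0.
  apply: (Rintegral_ge0_eq0_continuous (a := a) (b := b) (x := x)
    (G := fun y => \sum_(k < 3) g y 0 k * g y 0 k)) => //.
  - apply: measurable_funTS; apply: measurable_sum => k.
    by apply: measurable_funM; apply: Vx3_measurable; eassumption.
  - exact: (Vx3_dot_integrable _ ps gV gV).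
  - exact: in_cells_itv hs xC.
  - apply: cvg_sum_seq => k _.
    by apply: cvgM; exact: broken_poly_continuous oc (gV k) xC.
apply/rowP => k; rewrite [RHS]mxE; move/eqP: G0.
rewrite psumr_eq0; last by move=> i _; rewrite -expr2 sqr_ge0.
by move=> /allP/(_ k (mem_index_enum _)); rewrite -expr2 sqrf_eq0 => /eqP.
Qed.

Lemma ipx_cvg a b s kappa (eta_ : nat -> R -> 'rV[R]_3) eta q :
  path <%R a s -> (forall n, Vx3 a s kappa (eta_ n)) -> Vx3 a s kappa eta ->
  Vx3 a s kappa q ->
  (forall e : R, 0 < e -> \forall n \near \oo,
     forall x k, `|eta_ n x 0 k - eta x 0 k| <= e) ->
  ipx a b (eta_ n) q @[n --> \oo] --> ipx a b eta q.
Proof.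
move=> ps enV eV qV ecv.
have [A AP] := choice (Vx3_bounded ps eV).
have [B BP] := choice (Vx3_bounded ps qV).
have [N _ NP] := ecv 1 ltr01.
rewrite -(cvg_shiftn N) /=.
apply: (Rintegral_dominated_cvg (mu := mu) (g := cst (\sum_(k < 3) (A k + 1) * B k))) => //.
- by move=> n;
    have /integrableP[/measurable_EFinP] := Vx3_dot_integrable (a := a) b ps (enV (n + N)%N) qV.
- move=> x _; apply: cvg_sum_seq => k _; apply: cvgM; last exact: cvg_cst.
  rewrite (cvg_shiftn N (fun n => eta_ n x 0 k)).
  apply/cvgrPdistC_le => e e0; have := ecv e e0; apply: filterS => n; exact.
- apply: (bounded_itv_integrable a b (C := `|\sum_(k < 3) (A k + 1) * B k|)) => //.
- move=> n x _; apply: (le_trans (ler_norm_sum _ _ _)); apply: ler_sum => k _.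
  rewrite normrM ler_pM//.
  have := NP (n + N)%N (leq_addl _ _) x k => h.
  rewrite -[eta_ _ _ _ _](subrK (eta x 0 k)) (le_trans (ler_normD _ _))//.
  by rewrite addrC lerD.
Qed.

Lemma norm_cvg_le {T : Type} {F : set_system T} {FF : ProperFilter F}
    (g : T -> R) (l e : R) :
  g t @[t --> F] --> l -> (forall t, `|g t| <= e) -> `|l| <= e.
Proof.
by move=> gl ge; apply: (cvgr_to_le (cvg_norm gl)); apply: nearW.
Qed.

Lemma rtrace_dist a s kappa eta eta' (e : R) x k : path <%R a s ->
  Vx3 a s kappa eta -> Vx3 a s kappa eta' -> x \in belast a s ->
  (forall y k, `|eta' y 0 k - eta y 0 k| <= e) ->
  `|rtrace eta' x 0 k - rtrace eta x 0 k| <= e.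
Proof.
move=> ps V V' xs H.
apply: (norm_cvg_le (F := x^'+) (g := fun y => eta' y 0 k - eta y 0 k)) => //.
by apply: cvgB; apply: rtrace_cvg; eassumption.
Qed.

Lemma ltrace_dist a s kappa eta eta' (e : R) x k : path <%R a s ->
  Vx3 a s kappa eta -> Vx3 a s kappa eta' -> x \in s ->
  (forall y k, `|eta' y 0 k - eta y 0 k| <= e) ->
  `|ltrace eta' x 0 k - ltrace eta x 0 k| <= e.
Proof.
move=> ps V V' xs H.
apply: (norm_cvg_le (F := x^'-) (g := fun y => eta' y 0 k - eta y 0 k)) => //.
by apply: cvgB; apply: ltrace_cvg; eassumption.
Qed.

Lemma traceR_Maxw a s kappa eta x v : path <%R a s -> Vx3 a s kappa eta ->
  x \in belast a s -> realizable (rtrace eta x) ->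
  traceR (Maxw eta) x v = maxwellian (rtrace eta x) v.
Proof.
move=> ps eV xs eR; apply/cvg_lim => //; apply: maxwellian_cvg => // k.
exact: rtrace_cvg ps eV xs.
Qed.

Lemma traceL_Maxw a s kappa eta x v : path <%R a s -> Vx3 a s kappa eta ->
  x \in s -> realizable (ltrace eta x) ->
  traceL (Maxw eta) x v = maxwellian (ltrace eta x) v.
Proof.
move=> ps eV xs eR; apply/cvg_lim => //; apply: maxwellian_cvg => // k.
exact: ltrace_cvg ps eV xs.
Qed.

Lemma traceR_edot a s kappa q x v : path <%R a s -> Vx3 a s kappa q ->
  x \in belast a s -> traceR (edot q) x v = edot (fun=> rtrace q x) (x, v).
Proof.
move=> ps qV xs; apply/cvg_lim => //; apply: cvg_sum_seq => k _ /=.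
by apply: cvgM; [exact: cvg_cst|exact: (rtrace_cvg ps qV xs)].
Qed.

Lemma traceL_edot a s kappa q x v : path <%R a s -> Vx3 a s kappa q ->
  x \in s -> traceL (edot q) x v = edot (fun=> ltrace q x) (x, v).
Proof.
move=> ps qV xs; apply/cvg_lim => //; apply: cvg_sum_seq => k _ /=.
by apply: cvgM; [exact: cvg_cst|exact: (ltrace_cvg ps qV xs)].
Qed.

Lemma measurable_edot_cst u x : measurable_fun setT (fun v => edot (fun=> u) (x, v)).
Proof. by apply: measurableT_comp => //; apply: measurable_edot => k; exact:
  measurable_cst. Qed.

Lemma edot_cst_le u : exists2 Q : R, 0 <= Q &
  forall x v, `|edot (fun=> u) (x, v)| <= Q * expR (2 * `|v|).
Proof.
have [|Q Q0 QP] := edot_le_expR (q := fun=> u).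
  by move=> k; exists `|u 0 k|.
by exists Q => // x v; exact: QP.
Qed.

(** Dominated convergence: [realizable_with c] gives one Gaussian for the
    whole sequence. *)
Lemma maxwellian_integral_cvg (D : set R) (c C m : R) (h : R -> R)
    (u_ : nat -> 'rV[R]_3) u : 0 < c -> measurable D ->
  measurable_fun setT h -> (forall v, `|h v| <= C * expR (m * `|v|)) ->
  (forall n, realizable_with c (u_ n)) -> realizable_with c u ->
  (forall k, u_ n 0 k @[n --> \oo] --> u 0 k) ->
  \int[mu]_(v in D) (h v * maxwellian (u_ n) v) @[n --> \oo] -->
  \int[mu]_(v in D) (h v * maxwellian u v).
Proof.
move=> c0 mD mh hC unc uc ucv.
have [K [delta [d0 KP]]] := maxwellian_le_gauss c0.
have mM (w : 'rV[R]_3) : measurable_fun setT (fun v => maxwellian w v).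
  by apply: (measurable_maxwellian (e := fun=> w) (w := id)) => // k; exact: measurable_cst.
apply: (Rintegral_dominated_cvg (mu := mu) (g := fun v =>
  C * K * expR (m ^+ 2 / (2 * delta)) * gauss (delta / 2) v)) => //.
- by move=> n; apply: measurable_funTS; exact: (measurable_funM mh (mM _)).
- move=> v _; apply: cvgM; first exact: cvg_cst.
  by apply: maxwellian_cvg => //; exact: realizable_withW uc.
- by apply: integrable_scale => //; apply: integrable_gauss => //; rewrite divr_gt0.
- by move=> n v _; exact: expR_mul_gauss_le (KP _ v (unc n)) (hC v).
Qed.

Lemma maxwellian_integrable (D : set R) (c C m : R) (h : R -> R) u :
  0 < c -> measurable D ->
  measurable_fun setT h -> (forall v, `|h v| <= C * expR (m * `|v|)) ->
  realizable_with c u -> mu.-integrable D (EFin \o (fun v => h v * maxwellian u v)).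
Proof.
move=> c0 mD mh hC uc; have [K [delta [d0 KP]]] := maxwellian_le_gauss c0.
apply: (expR_gauss_bounded_integrable (C := C) (K := K) (delta := delta) (m := m)) => //.
- exact: measurable_funTS.
- apply: measurable_funTS.
  by apply: (measurable_maxwellian (e := fun=> u) (w := id)) => // k; exact: measurable_cst.
- by move=> v _; exact: KP.
Qed.

End Continuity.

(** * Continuity of the Maxwellian flux form *)

Section EformContinuity.
Context {R : realType}.
Local Notation mu := (@lebesgue_measure R).
Implicit Types (a b x : R) (s : seq R) (eta q : R -> 'rV[R]_3) (u : 'rV[R]_3).

(** The two test functions agree off the lines above the nodes, which have
    measure 0 in the plane. *)
Lemma edot_derivative a b s kappa q : itv_partition a b s -> Vx3 a s kappa q ->
  exists2 q', Vx3 a s kappa q' &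
    forall w : R * R -> R, ipxv a b w (dx (edot q)) = ipxv a b w (edot q').
Proof.
move=> hs qV; have [ps /eqP lb] := hs.
have H k : exists g', Vx a s kappa g' /\
    forall x, in_cells (xcells a s) x -> is_derive x 1 (fun x => q x 0 k) (g' x).
  have [g' g'V dg] := broken_poly_derivative (bounded_open_xcells ps) (qV k).
  by exists g'.
have [g gP] := choice H.
exists (fun x => \row_k g k x).
  move=> k; rewrite (_ : (fun x => _) = g k); first exact: (gP k).1.
  by apply/funext => x; rewrite mxE.
(* The lines above the right ends of the cells cover all points of
   ]a, b[ x R that lie above no open cell. *)
move=> w; pose N := [set` s] `*` [set: R].
have fs : finite_set [set` s] by exact: finite_seq.
have ms : measurable ([set` s] : set R) by exact: countable_measurable
  (finite_set_countable fs).
rewrite /ipxv; apply: (Rintegral_eq_off_null (mu := (mu \x mu)%E) (N := N)).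
- exact: measurableX.
- transitivity (mu [set` s] * mu [set: R])%E; first exact: product_measure1E.
  rewrite [X in (X * _)%E](_ : _ = 0%E) ?mul0e//.
  by apply: countable_lebesgue_measure0; exact: finite_set_countable.
- move=> [x v] /= [xab _] xN; congr (_ * _).
  have xC : in_cells (xcells a s) x.
    move: xab; rewrite in_itv /= => /andP[ax xb].
    have [||xs] := cells_cover ps ax; [by rewrite lb ltW|by []|].
    by exfalso; apply: xN; split.
  rewrite /dx /edot /= derive1E.
  have dk (k : 'I_3) : is_derive x (1 : R) (fun y => evec v 0 k * q y 0 k)
      (evec v 0 k * g k x).
    have D := (gP k).2 x xC.
    exact: is_deriveZ.
  have := is_derive_sum dk.
  rewrite (_ : \sum_(i < 3) _ = (fun y => \sum_(k < 3) evec v 0 k * q y 0 k)).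
    move=> D; rewrite (derive_val (is_derive := D)).
    by apply: eq_bigr => k _; rewrite mxE.
  by apply/funext => y; rewrite fct_sumE.
Qed.

Lemma normr_half_le_expR (v : R) :
  `|(v - `|v|) / 2| <= expR `|v| /\ `|(v + `|v|) / 2| <= expR `|v|.
Proof.
have := normr_le_expR v; move: (expR _) => E vE.
have := ler_norm v; have := ler_norm (- v); rewrite normrN => h1 h2.
by split; rewrite ler_norml; apply/andP; split; lra.
Qed.

Lemma expR_weight_mul (Q v t w : R) : `|t| <= expR `|v| -> `|w| <= Q * expR (2 * `|v|) ->
  `|t * w| <= Q * expR (3 * `|v|).
Proof.
move=> tv wQ; rewrite normrM (le_trans (ler_pM _ _ tv wQ))// mulrCA.
by rewrite -expRD (_ : `|v| + 2 * `|v| = 3 * `|v|)//; ring.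
Qed.

Section FixedBounds.
Variables (a b : R) (s : seq R) (kappa : nat) (c : R).
Hypotheses (hab : a < b) (hs : itv_partition a b s) (c0 : 0 < c).
Variables (eta_ : nat -> R -> 'rV[R]_3) (eta q : R -> 'rV[R]_3).
Hypotheses (enV : forall n, Vx3 a s kappa (eta_ n)) (eV : Vx3 a s kappa eta)
  (qV : Vx3 a s kappa q).
Hypotheses (enc : forall n, field_realizable_with c a s (eta_ n))
  (ec : field_realizable_with c a s eta).
Hypothesis ecv : forall e : R, 0 < e -> \forall n \near \oo,
  forall x k, `|eta_ n x 0 k - eta x 0 k| <= e.

Let ps : path <%R a s. Proof. by case: hs. Qed.

Lemma field_cvg x k : eta_ n x 0 k @[n --> \oo] --> eta x 0 k.
Proof. by apply/cvgrPdistC_le => e e0; have := ecv e0; apply: filterS => n; exact. Qed.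

Lemma rtrace_seq_cvg x k : x \in belast a s ->
  rtrace (eta_ n) x 0 k @[n --> \oo] --> rtrace eta x 0 k.
Proof.
move=> xs; apply/cvgrPdistC_le => e e0; have := ecv e0; apply: filterS => n H.
exact: rtrace_dist ps eV (enV n) xs H.
Qed.

Lemma ltrace_seq_cvg x k : x \in s ->
  ltrace (eta_ n) x 0 k @[n --> \oo] --> ltrace eta x 0 k.
Proof.
move=> xs; apply/cvgrPdistC_le => e e0; have := ecv e0; apply: filterS => n H.
exact: ltrace_dist ps eV (enV n) xs H.
Qed.

Lemma volume_cvg q' : Vx3 a s kappa q' ->
  ipxv a b (fun p => p.2 * Maxw (eta_ n) p) (edot q') @[n --> \oo] -->
  ipxv a b (fun p => p.2 * Maxw eta p) (edot q').
Proof.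
move=> q'V; have [K [delta [d0 MK]]] := Maxw_le_gauss (c := c) a s c0.
have [Q Q0 QP] := edot_le_expR (Vx3_bounded ps q'V).
have mD : measurable (`]a, b[ `*` setT : set (R * R)).
  by apply: measurableX => //; exact: measurable_itv.
have mF e : Vx3 a s kappa e ->
    measurable_fun setT (fun p : R * R => p.2 * Maxw e p * edot q' p).
  move=> V; apply: measurable_funM.
    by apply: measurable_funM; [exact: measurable_snd|exact: measurable_Maxw V].
  by apply: measurable_edot; exact: Vx3_measurable q'V.
pose K' := Q * K * expR (3 ^+ 2 / (2 * delta)).
have FK e : Vx3 a s kappa e -> field_realizable_with c a s e ->
    forall p, `|p.2 * Maxw e p * edot q' p| <= K' * gauss (delta / 2) p.2.
  move=> V H p; rewrite mulrAC.
  apply: expR_mul_gauss_le (MK _ e V H p) _ => //.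
  by apply: expR_weight_mul (QP p); exact: normr_le_expR.
have d20 : 0 < delta / 2 by rewrite divr_gt0.
have mg : measurable_fun setT (fun p : R * R => K' * gauss (delta / 2) p.2).
  apply: measurable_funM => //.
  by apply: (measurableT_comp (measurable_gauss _ (D := setT))); exact: measurable_snd.
apply: (Rintegral_dominated_cvg (mu := (mu \x mu)%E)
  (g := fun p => K' * gauss (delta / 2) p.2)) => //.
- by move=> n; apply: measurable_funTS; exact: mF.
- move=> [x v] _ /=; apply: cvgM; last exact: cvg_cst.
  apply: cvgM; first exact: cvg_cst.
  have [xC|xC] := pselect (in_cells (xcells a s) x).
    apply: maxwellian_cvg; last by move=> k; exact: field_cvg.
    by case: ec => H _ _; exact: realizable_withW (H x xC).
  rewrite /Maxw /= (Vx3_out eV xC) maxwellian0.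
  under eq_fun do rewrite (Vx3_out (enV _) xC) maxwellian0.
  exact: cvg_cst.
- apply: (integrable_slab a b (K := `|K'|) (delta := delta / 2)) => // p.
  by rewrite normrM [`|gauss _ _|]ger0_norm ?gauss_ge0.
- by move=> n p _; exact: FK.
Qed.

Lemma inflow_boundary_cvg :
  \int[mu]_(v in `]-oo, 0[) (v * traceR (Maxw (eta_ n)) a v * traceR (edot q) a v * -1)
  @[n --> \oo] -->
  \int[mu]_(v in `]-oo, 0[) (v * traceR (Maxw eta) a v * traceR (edot q) a v * -1).
Proof.
have abel : a \in belast a s.
  by move: hs hab; case: s => [/itv_partition_nil ->|*]; rewrite ?ltxx//= mem_head.
have [Q Q0 QP] := edot_cst_le (rtrace q a).
pose h v := - v * edot (fun=> rtrace q a) (a, v).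
have E e : Vx3 a s kappa e -> field_realizable_with c a s e ->
  \int[mu]_(v in `]-oo, 0[) (v * traceR (Maxw e) a v * traceR (edot q) a v * -1)
  = \int[mu]_(v in `]-oo, 0[) (h v * maxwellian (rtrace e a) v).
  move=> V [_ H _]; apply: eq_Rintegral => v _.
  rewrite (traceR_edot _ ps qV abel).
  rewrite (traceR_Maxw _ ps V abel); last exact: realizable_withW (H a abel).
  by rewrite /h; ring.
rewrite E//; under eq_fun do rewrite E//.
apply: (maxwellian_integral_cvg (c := c) (C := Q) (m := 3)) => //.
- by apply: measurable_funM => //; exact: measurable_edot_cst.
- move=> v; apply: expR_weight_mul (QP a v); rewrite normrN; exact: normr_le_expR.
- by move=> n; case: (enc n) => _ + _; exact.
- by case: ec => _ + _; exact.
- by move=> k; exact: rtrace_seq_cvg.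
Qed.

Lemma outflow_boundary_cvg :
  \int[mu]_(v in `]0, +oo[) (v * traceL (Maxw (eta_ n)) b v * traceL (edot q) b v * 1)
  @[n --> \oo] -->
  \int[mu]_(v in `]0, +oo[) (v * traceL (Maxw eta) b v * traceL (edot q) b v * 1).
Proof.
have bs : b \in s.
  move: hs hab; case: s => [/itv_partition_nil ->|x s' [_ /eqP <-] _].
    by rewrite ltxx.
  by rewrite /= mem_last.
have [Q Q0 QP] := edot_cst_le (ltrace q b).
pose h v := v * edot (fun=> ltrace q b) (b, v).
have E e : Vx3 a s kappa e -> field_realizable_with c a s e ->
  \int[mu]_(v in `]0, +oo[) (v * traceL (Maxw e) b v * traceL (edot q) b v * 1)
  = \int[mu]_(v in `]0, +oo[) (h v * maxwellian (ltrace e b) v).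
  move=> V [_ _ H]; apply: eq_Rintegral => v _.
  rewrite (traceL_edot _ ps qV bs).
  rewrite (traceL_Maxw _ ps V bs); last exact: realizable_withW (H b bs).
  by rewrite /h; ring.
rewrite E//; under eq_fun do rewrite E//.
apply: (maxwellian_integral_cvg (c := c) (C := Q) (m := 3)) => //.
- by apply: measurable_funM => //; exact: measurable_edot_cst.
- move=> v; apply: expR_weight_mul (QP b v); exact: normr_le_expR.
- by move=> n; case: (enc n) => _ _; exact.
- by case: ec => _ _; exact.
- by move=> k; exact: ltrace_seq_cvg.
Qed.

(** The upwind flux is a combination of the two traces,
    (v - |v|) / 2 times the right one plus (v + |v|) / 2 times the left one, so
    it reduces to two integrals against Maxwellians. *)
Lemma interior_flux_cvg x : x \in behead (belast a s) ->
  \int[mu]_(v in [set: R]) (flux (Maxw (eta_ n)) x v * jump (edot q) x v)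
  @[n --> \oo] -->
  \int[mu]_(v in [set: R]) (flux (Maxw eta) x v * jump (edot q) x v).
Proof.
move=> /interior_node[xb xs].
have [Q Q0 QP] := edot_cst_le (ltrace q x - rtrace q x).
pose J v := edot (fun=> ltrace q x - rtrace q x) (x, v).
pose hR v := (v - `|v|) / 2 * J v.
pose hL v := (v + `|v|) / 2 * J v.
have mJ : measurable_fun setT J by exact: measurable_edot_cst.
have mn : measurable_fun setT (fun v : R => `|v|) by exact: normr_measurable.
have mR : measurable_fun setT hR.
  apply: measurable_funM => //; apply: measurable_funM => //.
  exact: measurable_funB.
have mL : measurable_fun setT hL.
  apply: measurable_funM => //; apply: measurable_funM => //.
  exact: measurable_funD.
have hRQ v : `|hR v| <= Q * expR (3 * `|v|).
  exact: expR_weight_mul (normr_half_le_expR v).1 (QP x v).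
have hLQ v : `|hL v| <= Q * expR (3 * `|v|).
  exact: expR_weight_mul (normr_half_le_expR v).2 (QP x v).
have E e : Vx3 a s kappa e -> field_realizable_with c a s e ->
  \int[mu]_(v in [set: R]) (flux (Maxw e) x v * jump (edot q) x v)
  = \int[mu]_v (hR v * maxwellian (rtrace e x) v) +
    \int[mu]_v (hL v * maxwellian (ltrace e x) v).
  move=> V [_ HR HL]; rewrite -RintegralD//; last 2 first.
  - exact: (maxwellian_integrable c0 measurableT mR hRQ (HR x xb)).
  - exact: (maxwellian_integrable c0 measurableT mL hLQ (HL x xs)).
  apply: eq_Rintegral => v _; rewrite /flux /avg /jump.
  rewrite (traceR_edot _ ps qV xb) (traceL_edot _ ps qV xs).
  rewrite (traceR_Maxw _ ps V xb); last exact: realizable_withW (HR x xb).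
  rewrite (traceL_Maxw _ ps V xs); last exact: realizable_withW (HL x xs).
  rewrite /hR /hL (_ : J v = edot (fun=> ltrace q x) (x, v) - edot (fun=> rtrace q x) (x, v)).
    by field.
  rewrite /J /edot -sumrB; apply: eq_bigr => k _.
  by rewrite -mulrBr !mxE.
rewrite E//; under eq_fun do rewrite E//.
apply: cvgD.
- apply: (maxwellian_integral_cvg (c := c) (C := Q) (m := 3)) => //.
  + by move=> n; case: (enc n) => _ + _; exact.
  + by case: ec => _ + _; exact.
  + by move=> k; exact: rtrace_seq_cvg.
- apply: (maxwellian_integral_cvg (c := c) (C := Q) (m := 3)) => //.
  + by move=> n; case: (enc n) => _ _; exact.
  + by case: ec => _ _; exact.
  + by move=> k; exact: ltrace_seq_cvg.
Qed.

Lemma Eform_cvg_of_bound : Eform a b s (eta_ n) q @[n --> \oo] --> Eform a b s eta q.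
Proof.
have [q' q'V dq] := edot_derivative hs qV.
rewrite /Eform /Aform dq; under eq_fun do rewrite dq.
apply: cvgD; last by apply: cvgD; [exact: inflow_boundary_cvg|exact: outflow_boundary_cvg].
apply: cvgD; first by apply: cvgN; exact: volume_cvg.
by apply: cvg_sum_seq => x; exact: interior_flux_cvg.
Qed.

End FixedBounds.

(** From some index on the fields of the sequence satisfy the bounds of the
    limit with half the constant, and the shifted sequence falls under
    [Eform_cvg_of_bound]. *)
Lemma Eform_cvg a b s kappa (eta_ : nat -> R -> 'rV[R]_3) eta q : a < b ->
  itv_partition a b s ->
  (forall n, Vx3 a s kappa (eta_ n)) -> Vx3 a s kappa eta -> Vx3 a s kappa q ->
  realizable_field a s eta ->
  (forall e : R, 0 < e -> \forall n \near \oo,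
     forall x k, `|eta_ n x 0 k - eta x 0 k| <= e) ->
  Eform a b s (eta_ n) q @[n --> \oo] --> Eform a b s eta q.
Proof.
move=> hab hs enV eV qV eR ecv; have [ps _] := hs.
have [c c0 [cC cR cL]] := realizable_field_with ps eV eR.
have [eps eps0 pert] := realizable_with_perturb c0.
have [N _ NP] := ecv eps eps0.
have c20 : 0 < c / 2 by rewrite divr_gt0.
have cc : c / 2 <= c by rewrite ler_pdivrMr// ler_peMr ?(ltW c0)// ler1n.
rewrite -(cvg_shiftn N) /=.
apply: (Eform_cvg_of_bound (a := a) (b := b) (s := s) (kappa := kappa) (c := c / 2)) => //.
- move=> n; have H := NP (n + N)%N (leq_addl _ _); split.
  + by move=> x xC; apply: pert (cC x xC) _ => k.
  + by move=> x xs; apply: pert (cR x xs) _ => k; exact: rtrace_dist ps eV _ xs _.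
  + by move=> x xs; apply: pert (cL x xs) _ => k; exact: ltrace_dist ps eV _ xs _.
- by split=> x xx; apply: (realizable_with_le (c := c)) => //; [exact: cC|exact: cR|exact: cL].
- move=> e e0; have [M _ MP] := ecv e e0; exists M => // n /= Mn.
  by apply: MP; rewrite /= (leq_trans Mn)// leq_addr.
Qed.

End EformContinuity.

(** * The iteration and its limit *)

Section TestFunctions.
Context {R : realType}.

Lemma edot_hatVh (a : R) (s : seq R) (kappa : nat) (vmax : R) (Nv : nat) q :
  Vx3 a s kappa q -> hatVh a s kappa vmax Nv (edot q).
Proof.
move=> qV; exists 3%N, (fun k x => q x 0 k), (fun k v => evec v 0 k).
split; last by apply/funext => p; apply: eq_bigr => k _; rewrite mulrC.
move=> k; split; first exact: qV.
move=> I _; move: k; apply: ord3_case.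
- exists 1; first by rewrite size_poly1.
  by move=> v _; rewrite mxE hornerC.
- exists 'X; first by rewrite size_polyX.
  by move=> v _; rewrite mxE hornerX.
- exists (2^-1 *: 'X^2); first by rewrite (leq_trans (size_scale_leq _ _))// size_polyXn.
  by move=> v _; rewrite mxE hornerZ hornerXn mulrC.
Qed.

(** [A] is the value of the flux form at the iterate produced by the kinetic
    equation, which the next moment equation uses as known. *)
Lemma eliminate_flux (d n A B B' F m m0 r r2 : R) :
  m + d * (A + n * m) = m0 + d * n * r - d * B ->
  r2 = m0 - d * (A - F) - d * B' ->
  (1 + d * n) * m + d * F - d * (B' - B) = d * n * r + r2.
Proof.
move=> K ->.
have -> : (1 + d * n) * m + d * F - d * (B' - B) =
  (m + d * (A + n * m)) + d * F - d * (B' - B) - d * A by ring.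
by rewrite K; ring.
Qed.

(** The last hypothesis is the sum of the kinetic equation at step l and of the
    moment equation at step l + 1; the inflow terms of successive steps differ
    by a quantity that tends to 0. *)
Lemma limit_of_consecutive_steps (d n : R) (m r B F G : nat -> R)
    (ms rs Bs Fs Gs : R) :
  m l @[l --> \oo] --> ms -> r l @[l --> \oo] --> rs ->
  B l @[l --> \oo] --> Bs -> F l @[l --> \oo] --> Fs ->
  G l @[l --> \oo] --> Gs ->
  (forall l, (1 + d * n) * m l.+1 + d * F l.+1 - d * (B l.+1 - B l) =
    d * n * r l.+1 + (r l.+2 + d * G l.+2)) ->
  (1 + d * n) * ms + d * Fs = (1 + d * n) * rs + d * Gs.
Proof.
move=> mc rc Bc Fc Gc key.
have shift (u : nat -> R) (l : R) : u k @[k --> \oo] --> l ->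
    u k.+1 @[k --> \oo] --> l by rewrite -(cvg_shiftS u).
have scale (k : R) (u : nat -> R) (l : R) : u j @[j --> \oo] --> l ->
    k * u j @[j --> \oo] --> k * l.
  by move=> ul; apply: cvgM => //; exact: cvg_cst.
have L1 : (1 + d * n) * m l.+1 + d * F l.+1 - d * (B l.+1 - B l)
    @[l --> \oo] --> (1 + d * n) * ms + d * Fs - d * (Bs - Bs).
  apply: cvgB; first by apply: cvgD; apply: scale; exact: shift.
  by apply: scale; apply: cvgB => //; exact: shift.
have L2 : d * n * r l.+1 + (r l.+2 + d * G l.+2)
    @[l --> \oo] --> d * n * rs + (rs + d * Gs).
  apply: cvgD; first by apply: scale; exact: shift.
  apply: cvgD; first exact: (shift _ _ (shift _ _ rc)).
  by apply: scale; exact: (shift _ _ (shift _ _ Gc)).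
rewrite (funext key) in L1.
have := cvg_unique (@Rhausdorff R) L1 L2; rewrite subrr mulr0 subr0 => ->.
by ring.
Qed.

End TestFunctions.

Unset Implicit Arguments.

Theorem proposition3p1 (R : realType)
  (a b : R) (s : seq R) (kappa : nat) (vmax : R) (Nv : nat)
  (hab : a < b) (hs : itv_partition a b s)
  (hvmax : 0 < vmax) (hNv : (0 < Nv)%N) (hNv2 : ~~ odd Nv)
  (dt nu : R) (hdt : 0 < dt) (hnu : 0 < nu)
  (fk : R * R -> R) (hfk : Vh a s kappa vmax Nv fk)
  (fm : (R * R -> R) -> R * R -> R)
  (hfm : inflow_continuous a b s kappa vmax Nv fm)
  (Estar : (R -> 'rV[R]_3) -> (R -> 'rV[R]_3))
  (hEstar : forall eta, Vx3 a s kappa eta -> realizable_field a s eta ->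
     Vx3 a s kappa (Estar eta) /\
     forall q, Vx3 a s kappa q ->
       ipx a b (Estar eta) q
       = (1 + dt * nu) * ipx a b eta q + dt * Eform a b s eta q)
  (hinj : forall eta1 eta2,
     Vx3 a s kappa eta1 -> realizable_field a s eta1 ->
     Vx3 a s kappa eta2 -> realizable_field a s eta2 ->
     Estar eta1 = Estar eta2 -> eta1 = eta2)
  (f : nat -> R * R -> R) (rho : nat -> R -> 'rV[R]_3)
  (hf : forall l, Vh a s kappa vmax Nv (f l))
  (hrho : forall l, Vx3 a s kappa (rho l))
  (hrho_real : forall l, realizable_field a s (rho l.+1))
  (hf_real : forall l, realizable_field a s (moments (f l)))
  (hkinetic : forall l z, hatVh a s kappa vmax Nv z ->
     ipxv a b (f l.+1) z + dt * Lform a b s nu (f l.+1) z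
     = ipxv a b fk z + dt * nu * ipxv a b (Maxw (rho l.+1)) z
       - dt * Bform a b (fm (f l)) z)
  (hmoment : forall l q, Vx3 a s kappa q ->
     ipx a b (rho l.+1) q + dt * Eform a b s (rho l.+1) q
     = ipx a b (moments fk) q
       - dt * (Aform a b s (f l) (edot q) - Eform a b s (moments (f l)) q)
       - dt * Bform a b (fm (f l)) (edot q))
  (fs : R * R -> R) (rhos : R -> 'rV[R]_3)
  (hfs : Vh a s kappa vmax Nv fs) (hrhos : Vx3 a s kappa rhos)
  (hfs_real : realizable_field a s (moments fs))
  (hrhos_real : realizable_field a s rhos)
  (hf_cvg : {uniform, f @ \oo --> fs})
  (hrho_cvg : {uniform, rho @ \oo --> rhos}) :
  moments fs = rhos.
Proof.
have [ps _] := hs.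
have ucv := uniform_cvg_dist_le hf_cvg.
have ur e : 0 < e -> \forall n \near \oo,
    forall x k, `|rho n x 0 k - rhos x 0 k| <= e.
  move=> /(uniform_cvg_dist_le hrho_cvg); apply: filterS => n H x k.
  (* The norm of a row vector is the largest absolute value of its entries. *)
  rewrite (le_trans _ (H x))// (_ : _ - _ = (rho n x - rhos x) 0 k).
    by rewrite [leRHS]/Num.norm /= mx_normrE; exact: (le_bigmax _ _ (0, k)).
  by rewrite !mxE.
have mfV l := moments_Vh (hf l).
have mfsV := moments_Vh hfs.
have um := moments_uniform_cvg ps hf hfs ucv.
have Vpair g q : Vh a s kappa vmax Nv g -> Vx3 a s kappa q ->
    ipxv a b g (edot q) = ipx a b (moments g) q.
  move=> gV qV; have [K KP] := Vh_le_gauss ps gV.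
  apply: (ipxv_edot _ _ (K := K) (delta := 1)) => //.
  - exact: measurable_Vh gV.
  - exact: Vx3_measurable qV.
  - exact: Vx3_bounded ps qV.
have Mpair e q : Vx3 a s kappa e -> realizable_field a s e ->
    Vx3 a s kappa q -> ipxv a b (Maxw e) (edot q) = ipx a b e q.
  move=> eV eR qV; have [c c0 ec] := realizable_field_with ps eV eR.
  have [K [delta [d0 MK]]] := Maxw_le_gauss (c := c) a s c0.
  have eRR x : in_cells (xcells a s) x -> realizable (e x).
    by case: eR => H _ _ [I IC xI]; exact: H IC x xI.
  rewrite (ipxv_edot _ _ (K := K) (delta := delta) d0 _ (MK _ _ eV ec)).
  - by rewrite (moments_Maxw eV eRR).
  - exact: measurable_Maxw eV.
  - exact: Vx3_measurable qV.
  - exact: Vx3_bounded ps qV.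
have [E1V E1] := hEstar _ mfsV hfs_real.
have [E2V E2] := hEstar _ hrhos hrhos_real.
apply: hinj => //.
apply: (Vx3_ipx_inj (a := a) (b := b) (s := s) (kappa := kappa)) => // q qV.
rewrite (E1 q qV) (E2 q qV).
have zV : hatVh a s kappa vmax Nv (edot q) by exact: edot_hatVh.
have cB : Bform a b (fm (f n)) (edot q) @[n --> \oo] -->
    Bform a b (fm fs) (edot q) by exact: hfm.
have cm : ipx a b (moments (f n)) q @[n --> \oo] --> ipx a b (moments fs) q.
  exact: ipx_cvg ps mfV mfsV qV um.
have cr : ipx a b (rho n) q @[n --> \oo] --> ipx a b rhos q.
  exact: ipx_cvg ps hrho hrhos qV ur.
have cEm : Eform a b s (moments (f n)) q @[n --> \oo] -->
    Eform a b s (moments fs) q.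
  exact: Eform_cvg hab hs mfV mfsV qV hfs_real um.
have cEr : Eform a b s (rho n) q @[n --> \oo] --> Eform a b s rhos q.
  exact: Eform_cvg hab hs hrho hrhos qV hrhos_real ur.
(* The kinetic equation at step n produces f (n + 1), whose flux the moment
   equation at step n + 1 uses. *)
apply: (limit_of_consecutive_steps cm cr cB cEm cEr) => n.
have := hkinetic n _ zV; rewrite /Lform (Vpair _ _ (hf n.+1) qV)
  (Vpair _ _ hfk qV) (Mpair _ _ (hrho _) (hrho_real _) qV) => K1.
exact: eliminate_flux K1 (hmoment n.+1 q qV).
Qed.
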